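(* Let $\Gamma_{CK}=\langle a,b,c,d\mid[a,b]=[b,c]=[c,d]=1\rangle$ and let $X_{CK}$ be the universal cover of the standard Salvetti complex of this right-angled Artin group. Then the quotient $\mathrm{Aut}(X_{CK})/\overline{\mathrm{Aut}^+(X_{CK})}$ is not compact, while $\mathrm{Aut}^+(X_{CK})$ is simple, non-discrete, totally disconnected and locally compact.
   Context: $X_{CK}$ is the CAT(0) square complex obtained as the universal covering of the complex with one vertex, four oriented loops labeled $a,b,c,d$, and three squares glued along $aba^{-1}b^{-1}$, $bcb^{-1}c^{-1}$, $cdc^{-1}d^{-1}$. $\mathrm{Aut}(X_{CK})$ is the group of cubical automorphisms of $X_{CK}$ with the compact-open topology. $\mathrm{Aut}^+(X_{CK})$ is the subgroup generated by all elements that fix some halfspace of $X_{CK}$ pointwise (no closure taken), with the subspace topology, and $\overline{\mathrm{Aut}^+(X_{CK})}$ is its closure in $\mathrm{Aut}(X_{CK})$ (a normal subgroup). ''Simple'' is meant as an abstract group. *)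

(* Defs.v *)
From HB Require Import structures.
From mathcomp Require Import all_boot all_order all_algebra.
From mathcomp Require Import generic_quotient.
From mathcomp Require Import all_classical all_reals all_analysis.
Import Order.TTheory GRing.Theory Num.Theory.
Import numFieldNormedType.Exports.

Set Implicit Arguments.
Unset Strict Implicit.
Unset Printing Implicit Defensive.

Local Open Scope quotient_scope.
Local Open Scope classical_set_scope.

(* Square complexes in the style of Serre: an edge is a pair {e, dinv e} of
   mutually inverse darts (oriented edges), and a square is given by its boundary
   loops [e1, e2, e3, e4], i.e. by all the cyclic rotations of one such loop
   and of its inverse.  Loops and multiple edges are allowed; two squares
   with the same boundary loops are identified. *)
Record sqcomplex := SqComplex {
  vert : choiceType;
  dart : choiceType;
  org : dart -> vert;
  dinv : dart -> dart;
  square : dart -> dart -> dart -> dart -> Prop;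
  dinvK : involutive dinv;
  dinv_free : forall e, dinv e <> e;
  square_loop : forall e1 e2 e3 e4, square e1 e2 e3 e4 ->
    org (dinv e1) = org e2;
  square_rot : forall e1 e2 e3 e4, square e1 e2 e3 e4 -> square e2 e3 e4 e1;
  square_inv : forall e1 e2 e3 e4, square e1 e2 e3 e4 ->
    square (dinv e4) (dinv e3) (dinv e2) (dinv e1) }.

Arguments org {s}.
Arguments dinv {s}.
Arguments square {s}.

Section SquareComplex.
Variable X : sqcomplex.
Implicit Types (u v : vert X) (e f : dart X) (p q : seq (dart X)).

Definition tgt e : vert X := org (dinv e).

Fixpoint edge_path v p : Prop :=
  if p is e :: p' then org e = v /\ edge_path (tgt e) p' else True.

Definition endpoint v p : vert X := last v (map tgt p).

(* Combinatorial homotopy, relative to the endpoints, of edge paths from v. *)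
Inductive homotopic v : seq (dart X) -> seq (dart X) -> Prop :=
| homotopic_refl p : homotopic v p p
| homotopic_sym p q : homotopic v p q -> homotopic v q p
| homotopic_trans p q r :
    homotopic v p q -> homotopic v q r -> homotopic v p r
| homotopic_backtrack p q e :
    edge_path v (p ++ q) -> org e = endpoint v p ->
    homotopic v (p ++ [:: e; dinv e] ++ q) (p ++ q)
| homotopic_square p q e1 e2 e3 e4 :
    edge_path v (p ++ q) -> org e1 = endpoint v p -> square e1 e2 e3 e4 ->
    homotopic v (p ++ [:: e1; e2; e3; e4] ++ q) (p ++ q).

Definition simply_connected : Prop :=
  (forall u v, exists2 p, edge_path u p & endpoint u p = v) /\
  (forall v p, edge_path v p -> endpoint v p = v -> homotopic v p [::]).

End SquareComplex.

(* A covering is a surjective cellular map that is bijective on the star of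
   every vertex (darts and squares with a marked corner and orientation). *)
Record covering (X Y : sqcomplex)
    (pv : vert X -> vert Y) (pd : dart X -> dart Y) : Prop := Covering {
  covering_onto : forall w, exists v, pv v = w;
  covering_org : forall e, org (pd e) = pv (org e);
  covering_dinv : forall e, pd (dinv e) = dinv (pd e);
  covering_dart : forall v f, org f = pv v ->
    exists! e, org e = v /\ pd e = f;
  covering_square : forall e1 e2 e3 e4,
    square e1 e2 e3 e4 -> square (pd e1) (pd e2) (pd e3) (pd e4);
  covering_square_lift : forall v f1 f2 f3 f4,
    square f1 f2 f3 f4 -> org f1 = pv v ->
    exists e1 e2 e3 e4, [/\ square e1 e2 e3 e4, org e1 = v &
      [/\ pd e1 = f1, pd e2 = f2, pd e3 = f3 & pd e4 = f4]] }.

Definition universal_covering (X Y : sqcomplex)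
    (pv : vert X -> vert Y) (pd : dart X -> dart Y) : Prop :=
  covering pv pd /\ simply_connected X.

Section Halfspaces.
Variable X : sqcomplex.
Implicit Types (u v : vert X) (e f : dart X).

(* e and f belong to the same hyperplane: the equivalence relation on
   unoriented edges generated by being opposite edges of a square. *)
Inductive parallel : dart X -> dart X -> Prop :=
| parallel_refl e : parallel e e
| parallel_sym e f : parallel e f -> parallel f e
| parallel_trans e f g : parallel e f -> parallel f g -> parallel e g
| parallel_dinv e : parallel e (dinv e)
| parallel_square e1 e2 e3 e4 : square e1 e2 e3 e4 -> parallel e1 e3.

Definition avoids_hyperplane e (p : seq (dart X)) : Prop :=
  forall f, f \in p -> ~ parallel e f.

(* A halfspace, as a set of vertices: a connected component of the complement
   of the hyperplane dual to some edge e. *)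
Definition halfspace (H : set (vert X)) : Prop :=
  exists e v, H = [set u | exists p,
    [/\ edge_path v p, endpoint v p = u & avoids_hyperplane e p]].

End Halfspaces.

Record aut (X : sqcomplex) := Aut {
  autv : vert X -> vert X;
  autd : dart X -> dart X;
  autVv : vert X -> vert X;
  autVd : dart X -> dart X;
  autvK : cancel autv autVv;
  autVvK : cancel autVv autv;
  autdK : cancel autd autVd;
  autVdK : cancel autVd autd;
  aut_org : forall e, org (autd e) = autv (org e);
  aut_dinv : forall e, autd (dinv e) = dinv (autd e);
  aut_square : forall e1 e2 e3 e4, square e1 e2 e3 e4 <->
    square (autd e1) (autd e2) (autd e3) (autd e4) }.

Section AutGroup.
Variable X : sqcomplex.
Implicit Types g h k : aut X.

Lemma aut_eq g h : autv g =1 autv h -> autd g =1 autd h -> g = h.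
Proof.
case: g h => [v d v' d' vK v'K dK d'K o i s].
case=> [w f w' f' wK w'K fK f'K o' i' s'] /= /funext vw /funext df; subst w f.
have vw' : v' = w' by apply/funext => x; apply: (can_inj vK); rewrite v'K w'K.
have df' : d' = f' by apply/funext => x; apply: (can_inj dK); rewrite d'K f'K.
by subst w' f'; f_equal; exact: Prop_irrelevance.
Qed.

Definition aut1 : aut X.
Proof. by refine (@Aut X id id id id _ _ _ _ _ _ _). Defined.

Definition autM g h : aut X.
Proof.
refine (@Aut X (autv g \o autv h) (autd g \o autd h)
  (autVv h \o autVv g) (autVd h \o autVd g) _ _ _ _ _ _ _).
- exact: can_comp (autvK g) (autvK h).
- exact: can_comp (autVvK h) (autVvK g).
- exact: can_comp (autdK g) (autdK h).
- exact: can_comp (autVdK h) (autVdK g).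
- by move=> e /=; rewrite !aut_org.
- by move=> e /=; rewrite !aut_dinv.
- by move=> e1 e2 e3 e4 /=; rewrite -!aut_square.
Defined.

Definition autV g : aut X.
Proof.
refine (@Aut X (autVv g) (autVd g) (autv g) (autd g) _ _ _ _ _ _ _).
- exact: autVvK.
- exact: autvK.
- exact: autVdK.
- exact: autdK.
- by move=> e; apply: (can_inj (autvK g)); rewrite -aut_org autVdK autVvK.
- by move=> e; apply: (can_inj (autdK g)); rewrite aut_dinv !autVdK.
- by move=> e1 e2 e3 e4; rewrite [X in _ <-> X](aut_square g) !autVdK.
Defined.

HB.instance Definition _ := gen_eqMixin (aut X).
HB.instance Definition _ := gen_choiceMixin (aut X).

Lemma autMA : associative autM. Proof. by move=> g h k; exact: aut_eq. Qed.
Lemma aut1M : left_id aut1 autM. Proof. by move=> g; exact: aut_eq. Qed.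
Lemma autM1 : right_id aut1 autM. Proof. by move=> g; exact: aut_eq. Qed.
Lemma autVM : left_inverse aut1 autV autM.
Proof. by move=> g; apply: aut_eq => x /=; rewrite ?autvK ?autdK. Qed.
Lemma autMV : right_inverse aut1 autV autM.
Proof. by move=> g; apply: aut_eq => x /=; rewrite ?autVvK ?autVdK. Qed.

HB.instance Definition _ :=
  isGroup.Build (aut X) autMA aut1M autM1 autVM autMV.

End AutGroup.

Section Groups.
Local Open Scope group_scope.
Variable G : groupType.

Definition subgroup (H : set G) : Prop :=
  [/\ H 1, forall x y, H x -> H y -> H (x * y) & forall x, H x -> H x^-1].

Definition generated (S : set G) : set G := smallest subgroup S.

Definition normal_in (N H : set G) : Prop :=
  [/\ subgroup N, N `<=` H & forall x y, N x -> H y -> N (y^-1 * x * y)].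

Definition simple_subgroup (H : set G) : Prop :=
  [/\ subgroup H, H <> [set 1] &
      forall N, normal_in N H -> N = [set 1] \/ N = H].

Definition lcoset (N : set G) (g : G) : set G := [set g * x | x in N].

End Groups.

(* The halfspace is the full subcomplex spanned by the vertices in H; when its
   cells are determined by their vertices, it is fixed pointwise as soon as its
   vertices are. *)
Definition fixes_halfspace (X : sqcomplex) (g : aut X) : Prop :=
  exists2 H : set (vert X), halfspace H & forall v, H v -> autv g v = v.

(* No closure is taken. *)
Definition autplus (X : sqcomplex) : set (aut X) :=
  generated [set g | fixes_halfspace g].

Arguments autplus : clear implicits.

Section Realization.
Local Open Scope ring_scope.
Variables (R : realType) (X : sqcomplex).

Definition vpoint (v : vert X) : vert X -> R := fun u => (u == v)%:R.

Definition epoint (e : dart X) (t : R) : vert X -> R :=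
  fun u => (1 - t) * vpoint (org e) u + t * vpoint (tgt e) u.

Definition spoint (e1 e3 : dart X) (s t : R) : vert X -> R :=
  fun u => (1 - t) * epoint e1 s u + t * epoint (dinv e3) s u.

(* A point of a cell is encoded by the weights it gives to the vertices of the
   complex: (s, t) in the unit square with cyclically ordered corners
   v1, v2, v3, v4 has weights (1-s)(1-t), s(1-t), st, (1-s)t at these corners.
   The resulting set of functions, with pointwise convergence, is the usual
   realization when X is locally finite and its cells are embedded and determined
   by their vertices, which is the case for the CAT(0) complex below. *)
Definition realization : set {ptws vert X -> R} :=
  [set w | (exists v, w = vpoint v) \/
    (exists e t, [/\ 0 <= t, t <= 1 & w = epoint e t]) \/
    (exists e1 e2 e3 e4 s t, [/\ square e1 e2 e3 e4,
       0 <= s /\ s <= 1, 0 <= t /\ t <= 1 & w = spoint e1 e3 s t])].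

Lemma vpoint_aut (g : aut X) v : vpoint v \o autVv g = vpoint (autv g v).
Proof.
apply/funext => u; rewrite /vpoint /=; congr (_%:R); congr nat_of_bool.
by apply/eqP/eqP => [<-|->]; rewrite ?autVvK ?autvK.
Qed.

Lemma epoint_aut (g : aut X) e t : epoint e t \o autVv g = epoint (autd g e) t.
Proof.
apply/funext => u; rewrite /epoint /tgt -aut_dinv !aut_org -!vpoint_aut.
by [].
Qed.

Lemma realization_aut (g : aut X) (w : vert X -> R) :
  realization w -> realization (w \o autVv g).
Proof.
move=> [[v ->]|[[e [t [t0 t1 ->]]]|]].
- by left; exists (autv g v); rewrite vpoint_aut.
- by right; left; exists (autd g e), t; split=> //; rewrite epoint_aut.
- move=> [e1 [e2 [e3 [e4 [s [t [sq s01 t01 ->]]]]]]]; right; right.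
  exists (autd g e1), (autd g e2), (autd g e3), (autd g e4), s, t; split=> //.
    by rewrite -aut_square.
  apply/funext => u; rewrite /spoint -aut_dinv -!epoint_aut.
  by [].
Qed.

(* The homeomorphism of the realization that extends g affinely on each cell. *)
Definition realize (g : aut X) (w : realization) : realization :=
  SigSub (mem_set (realization_aut g (set_valP w))).

Definition aut_top : Type :=
  initial_topology (realize : aut X -> {compact-open, realization -> realization}).

HB.instance Definition _ := Topological.on aut_top.

End Realization.

(* Aut^+ as a subset of the topological space Aut; coerced to a type it carries
   the subspace topology. *)
Definition autplus_top (R : realType) (X : sqcomplex) : set (aut_top R X) :=
  autplus X.

Arguments autplus_top : clear implicits.

(* G/N with the quotient topology: two elements are identified when their left
   cosets agree as sets, so that N is not required to be a subgroup. *)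
Section CosetSpace.
Variables (R : realType) (X : sqcomplex) (N : set (aut_top R X)).

Definition coset_rel : rel (aut_top R X) :=
  fun g h => `[< lcoset (N : set (aut X)) g = lcoset (N : set (aut X)) h >].

Lemma coset_rel_refl : reflexive coset_rel.
Proof. by move=> g; apply/asboolP. Qed.
Lemma coset_rel_sym : symmetric coset_rel.
Proof. by move=> g h; apply/asboolP/asboolP. Qed.
Lemma coset_rel_trans : transitive coset_rel.
Proof. by move=> h g k /asboolP gh /asboolP hk; apply/asboolP; rewrite gh. Qed.

Canonical coset_equiv :=
  EquivRel coset_rel coset_rel_refl coset_rel_sym coset_rel_trans.

Definition coset_space : Type := quotient_topology {eq_quot coset_equiv}.

HB.instance Definition _ := Topological.on coset_space.

End CosetSpace.

Definition discrete_space (T : topologicalType) : Prop :=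
  forall A : set T, open A.

Inductive generator := ga | gb | gc | gd.

Definition nat_of_generator s : nat :=
  match s with ga => 0 | gb => 1 | gc => 2 | gd => 3 end.
Definition generator_of_nat n : generator :=
  match n with 0 => ga | 1 => gb | 2 => gc | _ => gd end.
Lemma generatorK : cancel nat_of_generator generator_of_nat.
Proof. by case. Qed.
HB.instance Definition _ := Countable.copy generator (can_type generatorK).

(* (s, false) stands for s and (s, true) for its inverse. *)
Definition letter : Type := (generator * bool)%type.
HB.instance Definition _ := Countable.on letter.

Definition linv (x : letter) : letter := (x.1, ~~ x.2).

Definition commutator (s t : generator) : seq letter :=
  [:: (s, false); (t, false); (s, true); (t, true)].

Definition relators : seq (seq letter) :=
  [:: commutator ga gb; commutator gb gc; commutator gc gd].

Definition salvetti_square (x1 x2 x3 x4 : letter) : Prop :=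
  exists2 r, r \in relators & exists i,
    [:: x1; x2; x3; x4] = rot i r \/
    [:: x1; x2; x3; x4] = rot i (rev (map linv r)).

Local Ltac find_rot :=
  first [by exists 0; left | by exists 1; left | by exists 2; left
       | by exists 3; left | by exists 0; right | by exists 1; right
       | by exists 2; right | by exists 3; right].

Lemma salvetti_squareP x1 x2 x3 x4 : salvetti_square x1 x2 x3 x4 <->
  [/\ x3 = linv x1, x4 = linv x2 &
      (x1.1, x2.1) \in [:: (ga, gb); (gb, ga); (gb, gc); (gc, gb);
                           (gc, gd); (gd, gc)]].
Proof.
split.
  move=> [r rin [i]].
  suff: all (fun w : seq letter => if w is [:: y1; y2; y3; y4] then
      [&& y3 == linv y1, y4 == linv y2 &
      (y1.1, y2.1) \in [:: (ga, gb); (gb, ga); (gb, gc); (gc, gb);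
                           (gc, gd); (gd, gc)]] else false)
      [:: rot i r; rot i (rev (map linv r))].
    by case/and3P=> + + _ [] E; rewrite -E => A B;
      [case/and3P: A|case/and3P: B] => /eqP -> /eqP ->.
  move: rin; rewrite !inE => /or3P[] /eqP -> {r};
    by case: i => [|[|[|[|i]]]].
move=> [-> ->]; case: x1 x2 => [s1 b1] [s2 b2] /=.
rewrite !inE /salvetti_square /relators.
case: s1; case: s2 => //= _; case: b1; case: b2;
  first [by exists (commutator ga gb) => //; find_rot
       | by exists (commutator gb gc) => //; find_rot
       | by exists (commutator gc gd) => //; find_rot].
Qed.

Lemma linvK : involutive linv.
Proof. by case=> s []. Qed.

Lemma linv_free x : linv x <> x.
Proof. by case: x => s []. Qed.

Lemma salvetti_square_rot x1 x2 x3 x4 :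
  salvetti_square x1 x2 x3 x4 -> salvetti_square x2 x3 x4 x1.
Proof.
move=> /salvetti_squareP[-> -> H]; apply/salvetti_squareP; split => //.
  by rewrite linvK.
by move: H; case: x1 x2 => [[] ?] [[] ?].
Qed.

Lemma salvetti_square_inv x1 x2 x3 x4 : salvetti_square x1 x2 x3 x4 ->
  salvetti_square (linv x4) (linv x3) (linv x2) (linv x1).
Proof.
move=> /salvetti_squareP[-> -> H]; apply/salvetti_squareP.
rewrite !linvK; split => //.
by move: H; case: x1 x2 => [[] ?] [[] ?].
Qed.

Definition salvetti : sqcomplex :=
  @SqComplex unit letter (fun=> tt) linv salvetti_square linvK linv_free
    (fun _ _ _ _ _ => erefl) salvetti_square_rot salvetti_square_inv.

Definition word_rel : rel (seq letter) :=
  fun w1 w2 => `[< homotopic (X := salvetti) tt w1 w2 >].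

Lemma word_rel_refl : reflexive word_rel.
Proof. by move=> w; apply/asboolP; exact: homotopic_refl. Qed.
Lemma word_rel_sym : symmetric word_rel.
Proof. by move=> v w; apply/asboolP/asboolP; exact: homotopic_sym. Qed.
Lemma word_rel_trans : transitive word_rel.
Proof.
move=> w v z /asboolP vw /asboolP wz; apply/asboolP.
exact: homotopic_trans vw wz.
Qed.
Canonical word_equiv :=
  EquivRel word_rel word_rel_refl word_rel_sym word_rel_trans.

(* Gamma_CK = <a, b, c, d | [a, b] = [b, c] = [c, d] = 1>, as the set of words
   modulo insertion and deletion of x x^-1 and of the (cyclic conjugates and
   inverses of the) relators; these words are the edge loops of the Salvetti
   complex at its only vertex. *)
Definition Gamma_CK : choiceType := {eq_quot word_equiv}.

Definition wclass (w : seq letter) : Gamma_CK := \pi_{eq_quot word_equiv} w.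

Definition wrepr (g : Gamma_CK) : seq letter :=
  repr (g : {eq_quot word_equiv}).

(* Right multiplication by a letter. *)
Definition gact (g : Gamma_CK) (x : letter) : Gamma_CK :=
  wclass (rcons (wrepr g) x).

Lemma wreprK : cancel wrepr wclass.
Proof. exact: reprK. Qed.

Lemma wclassP w w' :
  wclass w = wclass w' <-> homotopic (X := salvetti) tt w w'.
Proof.
split=> [/eqmodP/asboolP //|H]; exact/eqmodP/asboolP.
Qed.

Lemma salvetti_path v w : edge_path (X := salvetti) v w.
Proof. by elim: w v => //= x w IH v; split; [case: v|]. Qed.

Lemma homotopic_catr (w w' z : seq letter) :
  homotopic (X := salvetti) tt w w' ->
  homotopic (X := salvetti) tt (w ++ z) (w' ++ z).
Proof.
elim=> [p|p q _|p q r _ IH1 _ IH2|p q e _ _|p q e1 e2 e3 e4 _ _ sq].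
- exact: homotopic_refl.
- exact: homotopic_sym.
- exact: homotopic_trans IH1 IH2.
- by rewrite -!catA; apply: homotopic_backtrack; [exact: salvetti_path|case: (endpoint _ _)].
- by rewrite -!catA; apply: homotopic_square; [exact: salvetti_path|case: (endpoint _ _)|].
Qed.

Lemma homotopic_catl (w w' z : seq letter) :
  homotopic (X := salvetti) tt w w' ->
  homotopic (X := salvetti) tt (z ++ w) (z ++ w').
Proof.
elim=> [p|p q _|p q r _ IH1 _ IH2|p q e _ _|p q e1 e2 e3 e4 _ _ sq].
- exact: homotopic_refl.
- exact: homotopic_sym.
- exact: homotopic_trans IH1 IH2.
- by rewrite !catA -[(_ ++ _) ++ q]catA; apply: homotopic_backtrack; [exact: salvetti_path|case: (endpoint _ _)].
- by rewrite !catA -[(_ ++ _) ++ q]catA; apply: homotopic_square; [exact: salvetti_path|case: (endpoint _ _)|].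
Qed.

Lemma gact_wclass w x : gact (wclass w) x = wclass (rcons w x).
Proof.
by apply/wclassP; rewrite -!cats1; apply/homotopic_catr/wclassP; rewrite wreprK.
Qed.

Lemma gactK g x : gact (gact g x) (linv x) = g.
Proof.
rewrite {2}/gact gact_wclass -[RHS]wreprK; apply/wclassP.
rewrite -!cats1 -catA -[X in homotopic _ _ X]cats0.
by apply: homotopic_backtrack; [exact: salvetti_path|case: (endpoint _ _)].
Qed.

Definition ck_org (e : Gamma_CK * letter) : Gamma_CK := e.1.

Definition ck_dinv (e : Gamma_CK * letter) : Gamma_CK * letter :=
  (gact e.1 e.2, linv e.2).

(* The closed lifts of the attaching loops of the squares of the Salvetti complex. *)
Definition ck_square (e1 e2 e3 e4 : Gamma_CK * letter) : Prop :=
  salvetti_square e1.2 e2.2 e3.2 e4.2 /\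
  [/\ gact e1.1 e1.2 = e2.1, gact e2.1 e2.2 = e3.1,
      gact e3.1 e3.2 = e4.1 & gact e4.1 e4.2 = e1.1].

Lemma ck_dinvK : involutive ck_dinv.
Proof. by case=> g x; rewrite /ck_dinv /= gactK linvK. Qed.

Lemma ck_dinv_free e : ck_dinv e <> e.
Proof. by case: e => g x [_ /linv_free]. Qed.

Lemma ck_square_loop e1 e2 e3 e4 :
  ck_square e1 e2 e3 e4 -> ck_org (ck_dinv e1) = ck_org e2.
Proof. by case=> _ []. Qed.

Lemma ck_square_rot e1 e2 e3 e4 :
  ck_square e1 e2 e3 e4 -> ck_square e2 e3 e4 e1.
Proof. by case=> /salvetti_square_rot ? []; split. Qed.

Lemma ck_square_inv e1 e2 e3 e4 : ck_square e1 e2 e3 e4 ->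
  ck_square (ck_dinv e4) (ck_dinv e3) (ck_dinv e2) (ck_dinv e1).
Proof.
case=> /salvetti_square_inv sq [H1 H2 H3 H4]; split => //=.
by rewrite !gactK; split.
Qed.

(* The universal cover of the Salvetti complex: its vertices are the homotopy
   classes of edge paths from the base point, and an edge labelled x joins g
   to g x.  See X_CK_universal_covering. *)
Definition X_CK : sqcomplex :=
  @SqComplex Gamma_CK (Gamma_CK * letter)%type ck_org ck_dinv ck_square
    ck_dinvK ck_dinv_free ck_square_loop ck_square_rot ck_square_inv.

Fixpoint ck_lift (g : Gamma_CK) (w : seq letter) : seq (dart X_CK) :=
  if w is x :: w' then (g, x) :: ck_lift (gact g x) w' else [::].

Definition gactw (g : Gamma_CK) (w : seq letter) : Gamma_CK := foldl gact g w.

Lemma gactw_wclass u w : gactw (wclass u) w = wclass (u ++ w).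
Proof.
elim: w u => [|x w IH] u /=; first by rewrite cats0.
by rewrite gact_wclass IH cat_rcons.
Qed.

Lemma ck_lift_cat g w z : ck_lift g (w ++ z) = ck_lift g w ++ ck_lift (gactw g w) z.
Proof. by elim: w g => //= x w IH g; rewrite IH. Qed.

Lemma ck_lift_path g w : edge_path (X := X_CK) g (ck_lift g w).
Proof. by elim: w g => //= x w IH g; split=> //; exact: IH. Qed.

Lemma ck_lift_endpoint g w : endpoint (X := X_CK) g (ck_lift g w) = gactw g w.
Proof. by rewrite /endpoint; elim: w g => //= x w IH g; rewrite IH. Qed.

Lemma ck_lift_map (g : Gamma_CK) (p : seq (dart X_CK)) :
  edge_path (X := X_CK) g p -> p = ck_lift g (map snd p).
Proof.
by elim: p g => //= -[h x] p IH g [/= hg /IH {1}->]; rewrite -hg.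
Qed.

Lemma gactw_homotopic g (w w' : seq letter) :
  homotopic (X := salvetti) tt w w' -> gactw g w = gactw g w'.
Proof.
move=> ww'; rewrite -[g]wreprK !gactw_wclass; apply/wclassP.
exact: homotopic_catl.
Qed.

Lemma ck_lift_homotopic g (w w' : seq letter) :
  homotopic (X := salvetti) tt w w' ->
  homotopic (X := X_CK) g (ck_lift g w) (ck_lift g w').
Proof.
elim=> [p|p q _|p q r _ IH1 _ IH2|p q e H1 H2|p q e1 e2 e3 e4 H1 H2 sq].
- exact: homotopic_refl.
- exact: homotopic_sym.
- exact: homotopic_trans IH1 IH2.
- rewrite (ck_lift_cat g p q) ck_lift_cat /= gactK.
  apply: (@homotopic_backtrack X_CK g _ _ (gactw g p, e)).
    by rewrite -ck_lift_cat; exact: ck_lift_path.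
  by rewrite ck_lift_endpoint.
- have E : gactw (gactw g p) [:: e1; e2; e3; e4] = gactw g p.
    apply: (@gactw_homotopic _ _ [::]).
    by apply: (@homotopic_square salvetti tt [::] [::]).
  rewrite (ck_lift_cat g p q) 2!ck_lift_cat E /=.
  apply: (@homotopic_square X_CK g _ _ (_, e1) (_, e2) (_, e3) (_, e4)).
  + by rewrite -ck_lift_cat; exact: ck_lift_path.
  + by rewrite ck_lift_endpoint.
  + by split.
Qed.

Lemma X_CK_simply_connected : simply_connected X_CK.
Proof.
split=> [g h|g p /ck_lift_map ->]; last first.
  set w := map snd p; rewrite ck_lift_endpoint -[g]wreprK gactw_wclass.
  move=> /wclassP.
  set u := wrepr g => uw; rewrite wreprK.
  suff: homotopic (X := salvetti) tt w [::] by move=> /(ck_lift_homotopic g).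
  pose u' := rev (map linv u).
  have u'u z : homotopic (X := salvetti) tt (u' ++ u ++ z) z.
    rewrite /u'; elim: (u) z => [|x v IH] z /=; first exact: homotopic_refl.
    rewrite rev_cons cat_rcons; apply: homotopic_trans (IH z).
    have := @homotopic_backtrack salvetti tt (rev (map linv v)) (v ++ z) (linv x).
    rewrite /= linvK; apply; first exact: salvetti_path.
    by case: (endpoint _ _).
  apply: homotopic_trans (homotopic_sym (u'u w)) _.
  apply: homotopic_trans (u'u [::]); rewrite cats0.
  exact: homotopic_catl.
exists (ck_lift g (rev (map linv (wrepr g)) ++ wrepr h)).
  exact: ck_lift_path.
rewrite ck_lift_endpoint -{1}[g]wreprK gactw_wclass -[RHS]wreprK.
apply/wclassP; rewrite catA -[X in homotopic _ _ X]cat0s.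
apply: homotopic_catr; elim: (wrepr g) => [|x v IH] /=; first exact: homotopic_refl.
rewrite rev_cons -cats1 catA -cat1s.
apply: (@homotopic_trans salvetti _ _ ([:: x] ++ [::] ++ [:: linv x])).
  by rewrite -catA; apply: homotopic_catl; rewrite catA; apply: homotopic_catr.
by apply: (@homotopic_backtrack salvetti tt [::] [::]).
Qed.

Lemma X_CK_universal_covering :
  @universal_covering X_CK salvetti (fun=> tt) (fun e => e.2).
Proof.
split; last exact: X_CK_simply_connected.
split=> //.
- by case; exists (wclass [::]).
- move=> g x _; exists (g, x); split=> //.
  by case=> h y [/= -> ->].
- by move=> e1 e2 e3 e4 [].
- move=> g x1 x2 x3 x4 sq _.
  exists (g, x1), (gact g x1, x2), (gact (gact g x1) x2, x3),
    (gact (gact (gact g x1) x2) x3, x4); split=> //; split=> //; split=> //=.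
  apply: (@gactw_homotopic g [:: x1; x2; x3; x4] [::]).
  by apply: (@homotopic_square salvetti tt [::] [::]).
Qed.

(* Main.v *)
(* Automorphisms of X_CK either preserve the labels of the edges or exchange a
   with d and b with c.  A label preserving automorphism only flips signs: it maps
   u x to (g u) x^(+-1).

   Noncompactness: the image of a vertex in the right-angled Coxeter group
   obtained by killing all squares, and further in the infinite dihedral group
   <a, d | a^2, d^2>, is insensitive to flips.  Hence the image of g 1 is
   constant on the left cosets of the closure of Aut^+, and it is unbounded.

   Structure of Aut^+: the hyperplane of an a-edge (u, ua) is a b-line, so a label
   preserving automorphism fixing u, ua and ub fixes this hyperplane and splits as a
   product of two elements fixing its sides.  It follows that Aut^+ contains the
   label preserving stabilizer of each vertex and is generated by the fixators
   of the sides of a-hyperplanes.  In particular Aut^+ is open, whence local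
   compactness; non-discreteness and total disconnectedness are then clear for
   the topology of pointwise convergence on vertices, with which the compact-open
   topology coincides.

   Simplicity (in the style of Tits): a-hyperplanes do not cross each other.
   If N is normal and nontrivial, some n in N displaces an a-half-space; using
   reflections in Aut^+, every a-half-space is displaced by some element of N, and
   by ping-pong every a-half-space H has pairwise disjoint translates n^j H
   (j >= 0) for some n in N.  If g is supported in H, then the infinite product x
   of the n^j g n^-j lies in Aut^+ and g = x n x^-1 n^-1 belongs to N. *)

Require Import Defs.
From mathcomp Require Import all_boot all_order all_algebra.
From mathcomp Require Import all_classical all_reals all_analysis.
From mathcomp Require Import zify.

Set Implicit Arguments.
Unset Strict Implicit.
Unset Printing Implicit Defensive.

Import Order.TTheory GRing.Theory Num.Theory.
Import numFieldNormedType.Exports.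
Local Open Scope classical_set_scope.
(* The analysis library shadows dinv. *)
Local Notation dinv := Defs.dinv.

(** * The group and label preserving maps *)

Definition adjg (s t : generator) : bool :=
  (s, t) \in [:: (ga, gb); (gb, ga); (gb, gc); (gc, gb); (gc, gd); (gd, gc)].

Lemma adjg_sym s t : adjg s t = adjg t s.
Proof. by case: s; case: t. Qed.

Lemma adjg_neq s t : adjg s t -> s != t.
Proof. by case: s; case: t. Qed.

Definition gone : Gamma_CK := wclass [::].

Lemma gactKV g x : gact (gact g (linv x)) x = g.
Proof. by rewrite -{2}[x]linvK gactK. Qed.

Lemma gactC g x y : adjg x.1 y.1 -> gact (gact g x) y = gact (gact g y) x.
Proof.
move=> xy; have: gactw g [:: x; y; linv x; linv y] = gactw g [::].
  apply: gactw_homotopic; apply: (@homotopic_square salvetti tt [::] [::]) => //.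
  exact/salvetti_squareP.
by move=> /= {2}<-; rewrite !gactKV.
Qed.

Lemma gamma_ind (P : Gamma_CK -> Prop) :
  P gone -> (forall g x, P g -> P (gact g x)) -> forall g, P g.
Proof.
move=> P1 Px g; rewrite -(wreprK g); elim/last_ind: (wrepr g) => // w x IH.
by rewrite -gact_wclass; exact: Px.
Qed.

Lemma gamma_ind_from v (P : Gamma_CK -> Prop) :
  P v -> (forall g x, P g -> P (gact g x)) -> forall g, P g.
Proof.
move=> Pv Px; apply: (gamma_ind _ Px).
move: Pv; elim/gamma_ind: v => // g x IH /(Px _ (linv x)).
by rewrite gactK.
Qed.

Section Fold.
Variables (T : Type) (act : T -> letter -> T).
Hypothesis actK : forall t x, act (act t x) (linv x) = t.
Hypothesis actC : forall t x y, adjg x.1 y.1 -> act (act t x) y = act (act t y) x.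

(** Undoing the word of [v] before reading that of [g] gives recursion from any base vertex, with
    value [t] at [v]. [actK] and [actC] make the fold invariant under homotopy. *)
Definition gfold v t (g : Gamma_CK) : T :=
  foldl act (foldl act t (rev (map linv (wrepr v)))) (wrepr g).

Lemma foldl_homotopic t w w' :
  homotopic (X := salvetti) tt w w' -> foldl act t w = foldl act t w'.
Proof.
move=> ww'; elim: ww' t => {w w'} //.
- by move=> p q r _ IH1 _ IH2 t; rewrite IH1 IH2.
- by move=> p q e _ _ t; rewrite !foldl_cat /= actK.
- move=> p q e1 e2 e3 e4 _ _ /salvetti_squareP[-> -> e12] t.
  by rewrite !foldl_cat /= actC // actK actK.
Qed.

Lemma gfold_gact v t g x : gfold v t (gact g x) = act (gfold v t g) x.
Proof.
rewrite /gfold; set t1 := foldl _ t _.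
rewrite -[RHS](@foldl_rcons _ _ act t1 (wrepr g) x).
by apply/foldl_homotopic/wclassP; rewrite wreprK.
Qed.

Lemma gfold_base v t : gfold v t v = t.
Proof.
rewrite /gfold -foldl_cat.
suff -> : forall w, foldl act t (rev (map linv w) ++ w) = t by [].
elim=> // x w IH; rewrite /= rev_cons cat_rcons foldl_cat /=.
by rewrite -{2}(linvK x) actK -foldl_cat.
Qed.

End Fold.

(* Exponent sums, i.e. the abelianization of Gamma_CK. *)
Definition exstep (s : generator) (n : int) (x : letter) : int :=
  (n + (if x.1 == s then if x.2 then -1 else 1 else 0))%R.

Definition ex (s : generator) : Gamma_CK -> int := gfold (exstep s) gone 0%R.

Lemma ex_gact s g x : ex s (gact g x) = exstep s (ex s g) x.
Proof.
apply: gfold_gact => [t [r b]|t [r b] [r' b'] _]; rewrite /exstep /=.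
  by case: eqP => _; case: b => /=; lia.
by do 2!case: eqP => _; case: b; case: b'; lia.
Qed.

Lemma gact_inj g x y : gact g x = gact g y -> x = y.
Proof.
move=> e0; have {e0} : forall s, ex s (gact g x) = ex s (gact g y) by rewrite e0.
case: x y => [s b] [s' b'] e.
move: (e s') (e s) => {e}; rewrite !ex_gact /exstep /= !eqxx [s' == s]eq_sym.
by case: eqP => [->|_]; case: b; case: b' => //; lia.
Qed.

Lemma same_labelP (x y : letter) : x.1 = y.1 -> y = x \/ y = linv x.
Proof. by case: x y => s [] [s' []] /= ->; [left|right|right|left]. Qed.

(** In a closed path of length four only [x] and [y] contribute to the exponent of [x.1], so they
    cancel. Hence label preserving maps send squares to squares. *)
Lemma opposite_sides g x y z t : y.1 = x.1 -> x.1 != z.1 -> t.1 != x.1 ->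
  g = gact (gact (gact (gact g x) z) y) t -> y = linv x.
Proof.
move=> yx xz tx /(congr1 (ex x.1)); rewrite !ex_gact /exstep yx eqxx.
rewrite [z.1 == _]eq_sym (negPf xz) (negPf tx).
by case: x y yx {xz tx} => [s []] [s' []] /= -> // /eqP; lia.
Qed.

(** * Sign flips and label preserving automorphisms *)

Definition flip (F : generator -> bool) (x : letter) : letter :=
  (x.1, x.2 (+) F x.1).

Lemma flip_linv F x : flip F (linv x) = linv (flip F x).
Proof. by rewrite /flip /linv /= addNb. Qed.

Lemma flipK F : involutive (flip F).
Proof. by case=> s b; rewrite /flip /= -addbA addbb addbF. Qed.

Definition gmove F v u : Gamma_CK -> Gamma_CK :=
  gfold (fun t x => gact t (flip F x)) v u.

Lemma gmove_gact F v u g x :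
  gmove F v u (gact g x) = gact (gmove F v u g) (flip F x).
Proof.
apply: gfold_gact => [t y|t y z yz]; first by rewrite flip_linv gactK.
by rewrite gactC.
Qed.

Lemma gmove_base F v u : gmove F v u v = u.
Proof. by apply: gfold_base => t y; rewrite flip_linv gactK. Qed.

Lemma gmoveK F v u : cancel (gmove F v u) (gmove F u v).
Proof.
apply: (gamma_ind_from (v := v)); first by rewrite !gmove_base.
by move=> g x IH; rewrite !gmove_gact IH flipK.
Qed.

(* Vertex maps inducing automorphisms of X_CK that preserve the labels. *)
Definition lp (f : Gamma_CK -> Gamma_CK) : Prop :=
  forall u x, f (gact u x) = gact (f u) x \/ f (gact u x) = gact (f u) (linv x).

Lemma lp_comp (f1 f2 : Gamma_CK -> Gamma_CK) : lp f1 -> lp f2 -> lp (f1 \o f2).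
Proof.
move=> l1 l2 u x /=; case: (l2 u x) => ->; first exact: l1.
by case: (l1 (f2 u) (linv x)) => ->; [right|left; rewrite linvK].
Qed.

Lemma lp_iter (f : Gamma_CK -> Gamma_CK) j : lp f -> lp (iter j f).
Proof.
by move=> lf; elim: j => [|j IH]; [move=> u x; left|exact: (lp_comp lf IH)].
Qed.

(* The action on darts; the sign of the image letter is read off the endpoints. *)
Definition lpdart (f : Gamma_CK -> Gamma_CK) (e : Gamma_CK * letter) :
    Gamma_CK * letter :=
  (f e.1, if f (gact e.1 e.2) == gact (f e.1) e.2 then e.2 else linv e.2).

Lemma lpdartP f e y : lp f -> f (gact e.1 e.2) = gact (f e.1) y ->
  lpdart f e = (f e.1, y).
Proof.
move=> lpf fe; rewrite /lpdart; case: eqP => [|ne].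
  by rewrite fe => /gact_inj ->.
have [/ne//|] := lpf e.1 e.2; by rewrite fe => /gact_inj ->.
Qed.

Lemma lpdart_tgt f e : lp f ->
  f (gact e.1 e.2) = gact (f e.1) (lpdart f e).2.
Proof. by move=> lpf; rewrite /lpdart /=; case: eqP => // ne; case: (lpf e.1 e.2). Qed.

Lemma lpdart_label f e : (lpdart f e).2.1 = e.2.1.
Proof. by rewrite /lpdart /=; case: ifP. Qed.

Lemma lpdart_comp f h e : lp f -> lp h -> lpdart f (lpdart h e) = lpdart (f \o h) e.
Proof.
move=> lpf lph; symmetry.
apply: (lpdartP (lp_comp lpf lph)); rewrite /comp lpdart_tgt //.
exact: (lpdart_tgt (lpdart h e) lpf).
Qed.

Lemma lpdart_can f h : lp f -> lp h -> cancel f h -> cancel (lpdart f) (lpdart h).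
Proof.
move=> lpf lph fK e; have c : lp (h \o f) by move=> u x /=; rewrite !fK; left.
rewrite lpdart_comp // (lpdartP (y := e.2) c) /= ?fK //.
by case: e.
Qed.

Lemma lpdart_dinv f e : lp f -> lpdart f (ck_dinv e) = ck_dinv (lpdart f e).
Proof.
move=> lpf; rewrite (lpdartP (y := linv (lpdart f e).2)) //.
  by rewrite /ck_dinv lpdart_tgt.
by rewrite gactK lpdart_tgt // gactK.
Qed.

Lemma lpdart_square f e1 e2 e3 e4 : lp f ->
  ck_square e1 e2 e3 e4 ->
  ck_square (lpdart f e1) (lpdart f e2) (lpdart f e3) (lpdart f e4).
Proof.
move=> lpf [/salvetti_squareP[s3 s4 s12] [h1 h2 h3 h4]].
have k1 := lpdart_tgt e1 lpf; have k2 := lpdart_tgt e2 lpf.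
have k3 := lpdart_tgt e3 lpf; have k4 := lpdart_tgt e4 lpf.
have l1 := lpdart_label f e1; have l2 := lpdart_label f e2.
have l3 := lpdart_label f e3; have l4 := lpdart_label f e4.
have ne : e1.2.1 != e2.2.1 by apply: adjg_neq.
have o1 : (lpdart f e1).1 = f e1.1 by [].
have o2 : (lpdart f e2).1 = f e2.1 by [].
have o3 : (lpdart f e3).1 = f e3.1 by [].
have o4 : (lpdart f e4).1 = f e4.1 by [].
rewrite h1 in k1; rewrite h2 in k2; rewrite h3 in k3; rewrite h4 in k4.
split; last by rewrite o1 o2 o3 o4 -k1 -k2 -k3 -k4.
apply/salvetti_squareP; rewrite l1 l2; split=> //.
- apply: (opposite_sides (g := f e1.1) (z := (lpdart f e2).2) (t := (lpdart f e4).2)).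
  + by rewrite l3 s3 l1.
  + by rewrite l1 l2.
  + by rewrite l4 l1 s4 eq_sym.
  + by rewrite {1}k4 k3 k2 k1.
- apply: (opposite_sides (g := f e2.1) (z := (lpdart f e3).2) (t := (lpdart f e1).2)).
  + by rewrite l4 s4 l2.
  + by rewrite l3 l2 s3 eq_sym.
  + by rewrite l1 l2.
  + by rewrite {1}k1 k4 k3 k2.
Qed.

Lemma lpdart_squareP f h e1 e2 e3 e4 : lp f -> lp h -> cancel f h ->
  ck_square e1 e2 e3 e4 <->
  ck_square (lpdart f e1) (lpdart f e2) (lpdart f e3) (lpdart f e4).
Proof.
move=> lpf lph fK; split; first exact: lpdart_square.
by move=> /(lpdart_square lph); rewrite !(lpdart_can lpf lph fK).
Qed.

Definition lp_aut f h (lpf : lp f) (lph : lp h) (fK : cancel f h)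
    (hK : cancel h f) : aut X_CK :=
  @Aut X_CK f (lpdart f) h (lpdart h) fK hK (lpdart_can lpf lph fK)
    (lpdart_can lph lpf hK) (fun=> erefl) (fun e => lpdart_dinv e lpf)
    (fun e1 e2 e3 e4 => lpdart_squareP e1 e2 e3 e4 lpf lph fK).

(** * Action of an arbitrary automorphism on labels *)

Definition lpa (g : aut X_CK) := lp (autv g).

Definition albl (g : aut X_CK) (u : Gamma_CK) (x : letter) : letter :=
  (autd g (u, x)).2.

Lemma autdE (g : aut X_CK) u x : autd g (u, x) = (autv g u, albl g u x).
Proof. by rewrite [LHS]surjective_pairing; congr pair; exact: (aut_org g (u, x)). Qed.

Lemma autv_gact (g : aut X_CK) u x :
  autv g (gact u x) = gact (autv g u) (albl g u x).
Proof.
by have := aut_org g (@dinv X_CK (u, x)); rewrite aut_dinv autdE /= => <-.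
Qed.

Lemma aut_ext (g h : aut X_CK) : autv g =1 autv h -> g = h.
Proof.
move=> gh; apply: aut_eq => // -[u x]; rewrite !autdE gh; congr pair.
by apply: (@gact_inj (autv h u)); rewrite -autv_gact -!gh autv_gact.
Qed.

Lemma albl_linv g u x : albl g (gact u x) (linv x) = linv (albl g u x).
Proof. by have := aut_dinv g ((u, x) : dart X_CK); rewrite /= /ck_dinv !autdE => -[]. Qed.

Lemma alblK g u x : albl (autV g) (autv g u) (albl g u x) = x.
Proof. by rewrite {1}/albl -autdE /= autdK. Qed.

Lemma albl_adj g u x y : adjg x.1 y.1 -> adjg (albl g u x).1 (albl g u y).1.
Proof.
move=> xy; have sq : @square X_CK (u, x) (gact u x, y)
    (gact (gact u x) y, linv x) (gact u y, linv y).
  split; first exact/salvetti_squareP.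
  by split=> //=; [rewrite [gact (gact u x) y]gactC|]; rewrite ?gactK.
move: sq => /(aut_square g) [/salvetti_squareP[_ + +] _].
rewrite !autdE /= albl_linv => /(congr1 linv); rewrite !linvK => E.
by rewrite -E.
Qed.

Definition gswap (b : bool) (s : generator) : generator :=
  if b then match s with ga => gd | gb => gc | gc => gb | gd => ga end else s.

Lemma gswap_inj s b b' : gswap b s = gswap b' s -> b = b'.
Proof. by case: s; case: b; case: b'. Qed.

(* The defining graph is a path, with a single nontrivial automorphism. *)
Lemma link_aut (F : generator -> generator) :
  (forall s t, adjg (F s) (F t) = adjg s t) -> exists b, F =1 gswap b.
Proof.
move=> Fadj; move: (Fadj ga gb) (Fadj gb gc) (Fadj gc gd) (Fadj ga gc) (Fadj gb gd)
  (Fadj ga gd) => {Fadj}.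
case Ea: (F ga); case Eb: (F gb) => //; case Ec: (F gc) => //;
case Ed: (F gd) => //= _ _ _ _ _ _; [exists false|exists true];
by case.
Qed.

(** Adjacency in the link is preserved. Distinct vertices of the defining graph have distinct
    neighbourhoods, so both signs of a generator get the same label and [link_aut] applies. *)
Lemma albl_swap_at g u : exists b, forall x, (albl g u x).1 = gswap b x.1.
Proof.
pose f' y := albl (autV g) (autv g u) y.
have f'K y : albl g u (f' y) = y.
  by have := alblK (autV g) (autv g u) y; rewrite /= autvK; congr (albl _ _ _ = _);
    exact: aut_ext.
have adjE x y : adjg (albl g u x).1 y.1 = adjg x.1 (f' y).1.
  apply/idP/idP => [/(albl_adj (autV g) (autv g u))|/(albl_adj g u)].
    by rewrite alblK.
  by rewrite f'K.
have same x y : x.1 = y.1 -> (albl g u x).1 = (albl g u y).1.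
  move=> xy; have: forall t, adjg (albl g u x).1 t = adjg (albl g u y).1 t.
    by move=> t; rewrite (adjE x (t, false)) (adjE y (t, false)) xy.
  move=> H; move: (H ga) (H gb) (H gc) (H gd) => {H}.
  by case: (albl g u x).1; case: (albl g u y).1.
have [|b Fb] := @link_aut (fun s => (albl g u (s, false)).1).
  by move=> s t; rewrite adjE /f' alblK.
by exists b => -[s c]; rewrite (same (s, c) (s, false)).
Qed.

(** The swaps seen from the two ends of an edge agree on its label, hence are equal. *)
Lemma albl_swap g : exists b, forall u x, (albl g u x).1 = gswap b x.1.
Proof.
have [b gb] := albl_swap_at g gone; exists b.
elim/gamma_ind => [//|u y IH]; have [b' gb'] := albl_swap_at g (gact u y).
suff <- : b' = b by [].
by apply: (@gswap_inj y.1); rewrite -(gb' (linv y)) albl_linv -IH.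
Qed.

Lemma lpaE g : lpa g <-> forall u x, (albl g u x).1 = x.1.
Proof.
split=> [lg u x|gE u x]; last first.
  by rewrite autv_gact; have [|->|->] := @same_labelP x (albl g u x); auto.
by have := lg u x; rewrite autv_gact => -[] /gact_inj ->.
Qed.

Lemma lpa_fix (g : aut X_CK) v (x : letter) : x.1 != gswap true x.1 ->
  autv g v = v -> autv g (gact v x) = gact v x -> lpa g.
Proof.
move=> sx gv gvx; have [b gb] := albl_swap g; apply/lpaE => u y.
suff bF : b = false by rewrite gb bF.
have: albl g v x = x by apply: (@gact_inj v); rewrite -{1}gv -autv_gact.
by move=> /(congr1 fst); rewrite gb; case: b {gb} => // e; rewrite e eqxx in sx.
Qed.

Section LabelPreserving.
Local Open Scope group_scope.

Lemma mulgVv (g : aut X_CK) u : autv g (autv g^-1 u) = u.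
Proof. exact: (autVvK g). Qed.

Lemma mulVgv (g : aut X_CK) u : autv g^-1 (autv g u) = u.
Proof. exact: (autvK g). Qed.

Lemma lpa1 : lpa 1. Proof. by move=> u x; left. Qed.

Lemma lpaM g h : lpa g -> lpa h -> lpa (g * h).
Proof.
move=> /lpaE lg /lpaE lh; apply/lpaE => u x.
have -> : albl (g * h) u x = albl g (autv h u) (albl h u x).
  by rewrite {2}/albl -autdE.
by rewrite lg lh.
Qed.

Lemma lpaV g : lpa g -> lpa g^-1.
Proof.
move=> /lpaE lg; apply/lpaE => u x.
have := alblK g^-1 u x; rewrite (_ : autV g^-1 = g); last exact: aut_ext.
by move=> /(congr1 fst) <-; rewrite lg.
Qed.

End LabelPreserving.

Lemma parallel_label (e f : dart X_CK) : parallel e f -> e.2.1 = f.2.1.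
Proof.
elim=> // {e f} [e f g _ -> _ -> //|e1 e2 e3 e4].
by case=> /salvetti_squareP[-> _ _] _.
Qed.

Lemma reach_gact e v (x : letter) : x.1 != e.2.1 ->
  exists p, [/\ edge_path (X := X_CK) v p, endpoint v p = gact v x &
     avoids_hyperplane (X := X_CK) e p].
Proof.
move=> xe; exists [:: (v, x)]; split=> // f; rewrite inE => /eqP-> /parallel_label.
by move=> ex; rewrite /= ex eqxx in xe.
Qed.

Lemma fixes_halfspace_lp (g : aut X_CK) : fixes_halfspace g ->
  lpa g /\ exists v, autv g v = v.
Proof.
case=> H [e [v ->]] gH.
have gv : autv g v = v by apply: gH; exists [::].
split; last by exists v.
(* With a label other than that of [e], the [x]-edge at [v] stays inside the halfspace. *)
pose x : letter := (if e.2.1 == ga then gb else ga, false).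
apply: (@lpa_fix g v x) => //; first by rewrite /x; case: (e.2.1 == ga) => /=.
apply: gH; apply: reach_gact; rewrite /x; case: (boolP (e.2.1 == ga)) => [/eqP->|] //.
by rewrite eq_sym.
Qed.

(* Walk on the Cayley graph of the infinite dihedral group <a, d | a^2, d^2>,
   which is a line: the state is the position together with its parity. *)
Definition posstep (p : int * bool) (x : letter) : int * bool :=
  match x.1 with
  | ga => ((if p.2 then p.1 - 1 else p.1 + 1)%R, ~~ p.2)
  | gd => ((if p.2 then p.1 + 1 else p.1 - 1)%R, ~~ p.2)
  | _ => p
  end.

Definition pos : Gamma_CK -> int * bool := gfold posstep gone (0%R, false).

Lemma pos_gact g x : pos (gact g x) = posstep (pos g) x.
Proof.
apply: gfold_gact => [[n b] [s c]|[n b] [s c] [s' c']]; rewrite /posstep /=.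
  by case: s => //=; rewrite negbK; case: b => /=; congr pair; lia.
by case: s; case: s'.
Qed.

Lemma pos_gone : pos gone = (0%R, false).
Proof.
by apply: gfold_base => [[n b] [s c]]; rewrite /posstep /=; case: s => //=;
  rewrite negbK; case: b => /=; congr pair; lia.
Qed.

(** Automorphisms act on the line by isometries. The direction is reversed once by the swap ([b])
    and once by an odd position of the image of the base vertex ([c]). *)
Lemma pos_aut (g : aut X_CK) : exists b : bool, forall u,
  pos (autv g u) = ((let: (z, c) := pos (autv g gone) in
    if b (+) c then z - (pos u).1 else z + (pos u).1)%R,
    (pos (autv g gone)).2 (+) (pos u).2).
Proof.
have [b gb] := albl_swap g; exists b.
elim/gamma_ind => [|u x IH].
  by rewrite pos_gone /=; case: (pos _) => z c /=; case: ifP => _; rewrite addbF;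
    congr pair; lia.
rewrite autv_gact !pos_gact IH /posstep gb.
case: (pos (autv g gone)) (pos u) => z c [z' c'] /= {IH}.
by case: b {gb}; case: x => -[] /= _; case: c; case: c' => //=; congr pair; lia.
Qed.

Section PosKernel.
Local Open Scope group_scope.

Definition pos_kernel : set (aut X_CK) :=
  [set n | lpa n /\ forall u, pos (autv n u) = pos u].

Lemma pos_kernel_subgroup : subgroup pos_kernel.
Proof.
split; first by split; [exact: lpa1|].
  move=> g h [lg pg] [lh ph]; split; first exact: lpaM.
  by move=> u; rewrite /= pg ph.
move=> g [lg pg]; split; first exact: lpaV.
by move=> u; rewrite -(pg (autv g^-1 u)) mulgVv.
Qed.

(** A generator of Aut^+ fixes a vertex and preserves labels, while [posstep] ignores signs. *)
Lemma autplus_pos_kernel : autplus X_CK `<=` pos_kernel.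
Proof.
move=> g; apply: smallest_sub; first exact: pos_kernel_subgroup.
move=> {}g /fixes_halfspace_lp[lg [v gv]]; split=> //.
apply: (gamma_ind_from (v := v)); first by rewrite gv.
by move=> u x IH; case: (lg u x) => ->; rewrite !pos_gact IH.
Qed.

Lemma autplus_lp g : autplus X_CK g -> lpa g.
Proof. by move/autplus_pos_kernel => -[]. Qed.

Lemma pos_autplus g n : autplus X_CK n ->
  (pos (autv (g * n) gone)).1 = (pos (autv g gone)).1.
Proof.
move=> /autplus_pos_kernel[_ pn]; have [b pg] := pos_aut g.
rewrite (_ : autv (g * n) gone = autv g (autv n gone)) // pg pn pos_gone.
by case: (pos _) => z c /=; case: ifP => _; lia.
Qed.

End PosKernel.

Lemma gmove_lp F v u : lp (gmove F v u).
Proof.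
move=> g x; rewrite gmove_gact; case: (@same_labelP x (flip F x)) => // ->;
by [left|right].
Qed.

Definition amove F v u : aut X_CK :=
  lp_aut (gmove_lp F v u) (gmove_lp F u v) (gmoveK F v u) (gmoveK F u v).

Lemma amove_lp F v u : lpa (amove F v u).
Proof. exact: gmove_lp. Qed.

Lemma pos_unbounded (n : nat) : exists g : aut X_CK,
  (pos (autv g gone)).1 = Posz n.*2.
Proof.
suff [u un] : exists u, pos u = (Posz n.*2, false).
  by exists (amove (fun=> false) gone u); rewrite /= gmove_base un.
elim: n => [|n [u un]]; first by exists gone; exact: pos_gone.
exists (gact (gact u (ga, false)) (gd, false)).
by rewrite !pos_gact un /posstep /=; congr pair; lia.
Qed.

(** * Hyperplanes *)

Implicit Types (e f : dart X_CK) (g h : aut X_CK) (u v : Gamma_CK) (x y : letter).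

Lemma parallel_dinvP (e f : dart X_CK) : parallel e (dinv f) <-> parallel e f.
Proof.
split=> H; apply: parallel_trans H _; last exact: parallel_dinv.
exact/parallel_sym/parallel_dinv.
Qed.

Lemma parallel_gact u (x y : letter) : adjg x.1 y.1 ->
  @parallel X_CK (u, x) (gact u y, x).
Proof.
move=> xy; apply: (@parallel_trans X_CK _ (@dinv X_CK (gact u y, x))).
  apply: (@parallel_square X_CK _ (gact u x, y) _ (gact u y, linv y)).
  split; first exact/salvetti_squareP.
  by split=> //=; rewrite ?gactK // gactC.
exact/parallel_sym/parallel_dinv.
Qed.

Lemma parallel_autd (g : aut X_CK) (e f : dart X_CK) :
  parallel e f <-> parallel (autd g e) (autd g f).
Proof.
suff H h (e' f' : dart X_CK) : parallel e' f' -> parallel (autd h e') (autd h f').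
  by split=> [|/(H (autV g))]; [exact: H|rewrite /= !autdK].
elim=> {e' f'} [e'|e' f' _|e' f' k _ H1 _ H2|e'|e1 e2 e3 e4].
- exact: parallel_refl.
- exact: parallel_sym.
- exact: parallel_trans H1 H2.
- by rewrite aut_dinv; exact: parallel_dinv.
- by move/(aut_square h); exact: parallel_square.
Qed.

(* sep e u: the vertex u is separated from the origin of e by the hyperplane
   of e. *)
Definition hstep (e : dart X_CK) (p : Gamma_CK * bool) (x : letter) :
    Gamma_CK * bool :=
  (gact p.1 x, p.2 (+) `[< parallel e (p.1, x) >]).

Definition sep (e : dart X_CK) (u : Gamma_CK) : bool :=
  (gfold (hstep e) e.1 (e.1, false) u).2.

Lemma hstepK e p x : hstep e (hstep e p x) (linv x) = p.
Proof.
case: p => g b; rewrite /hstep /= gactK; congr pair.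
rewrite (asbool_equiv_eq (parallel_dinvP e ((g, x) : dart X_CK))).
by rewrite -addbA addbb addbF.
Qed.

(** Both ways around a square cross the same hyperplanes, because opposite sides are parallel. *)
Lemma hstepC e p x y : adjg x.1 y.1 ->
  hstep e (hstep e p x) y = hstep e (hstep e p y) x.
Proof.
case: p => g b xy; rewrite /hstep /= gactC // -!addbA; congr (_, _ (+) _).
have trE (f k : dart X_CK) : parallel f k -> `[< parallel e f >] = `[< parallel e k >].
  move=> fk; apply/asbool_equiv_eq; split=> H; apply: parallel_trans H _ => //.
  exact: parallel_sym.
rewrite addbC (trE _ _ (parallel_gact g xy)); congr (_ (+) _).
by apply/esym/trE/parallel_gact; rewrite adjg_sym.
Qed.

Lemma hfoldE e u : gfold (hstep e) e.1 (e.1, false) u = (u, sep e u).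
Proof.
rewrite [LHS]surjective_pairing; congr pair.
elim/(@gamma_ind_from e.1): u => [|g x IH].
  by rewrite (gfold_base (@hstepK e)).
by rewrite (gfold_gact (@hstepK e) (@hstepC e)) /= IH.
Qed.

Lemma sep_gact e u x : sep e (gact u x) = sep e u (+) `[< parallel e (u, x) >].
Proof. by rewrite {1}/sep (gfold_gact (@hstepK e) (@hstepC e)) hfoldE. Qed.

Lemma sep_org e : sep e e.1 = false.
Proof. by rewrite /sep (gfold_base (@hstepK e)). Qed.

Lemma sep_gactN (e : dart X_CK) u (x : letter) : ~ parallel e (u, x) -> sep e (gact u x) = sep e u.
Proof. by move=> ?; rewrite sep_gact asboolF // addbF. Qed.

Lemma sep_gactT (e : dart X_CK) u (x : letter) : parallel e (u, x) -> sep e (gact u x) = ~~ sep e u.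
Proof. by move=> ?; rewrite sep_gact asboolT // addbT. Qed.

Lemma sep_gact_label e u x : x.1 <> e.2.1 -> sep e (gact u x) = sep e u.
Proof. by move=> xe; apply: sep_gactN => /parallel_label /esym. Qed.

Lemma sep_uniq e (S : Gamma_CK -> bool) : S e.1 = false ->
  (forall u x, S (gact u x) = S u (+) `[< parallel e (u, x) >]) -> S =1 sep e.
Proof.
move=> S1 Sx; apply: (gamma_ind_from (v := e.1)); first by rewrite S1 sep_org.
by move=> g x IH; rewrite Sx IH sep_gact.
Qed.

Lemma sep_tgt e : sep e (gact e.1 e.2) = true.
Proof.
by rewrite sep_gactT ?sep_org // -surjective_pairing; exact: parallel_refl.
Qed.

Lemma sep_autd (g : aut X_CK) e u : sep (autd g e) (autv g u) = sep e u.
Proof.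
apply: (sep_uniq (S := fun u => sep (autd g e) (autv g u))) => /= [|v x].
  by rewrite -(aut_org g e); exact: sep_org.
rewrite autv_gact sep_gact; congr (_ (+) _); apply/asbool_equiv_eq.
by rewrite -autdE -parallel_autd.
Qed.

Lemma sep_parallel e f u : parallel e f -> sep f u = sep e u (+) sep e f.1.
Proof.
move=> ef; symmetry; apply: (sep_uniq (S := fun u => sep e u (+) sep e f.1)).
  exact: addbb.
move=> v x /=; rewrite sep_gact addbAC; congr (_ (+) _).
apply/asbool_equiv_eq; split=> H; last exact: parallel_trans ef H.
by apply: parallel_trans H; exact: parallel_sym.
Qed.

Lemma sep_dinv e u : sep (dinv e) u = ~~ sep e u.
Proof.
rewrite (sep_parallel _ (parallel_dinv e)) (_ : (dinv e).1 = gact e.1 e.2) //.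
by rewrite sep_tgt addbT.
Qed.

(** Moving along the carrier of [f] uses labels adjacent to, hence different from, the common label;
    crossing [f] itself does not cross [e]. *)
Lemma sep_carrier e f f' : e.2.1 = f.2.1 -> ~ parallel e f -> parallel f f' ->
  sep e f'.1 = sep e f.1 /\ sep e (gact f'.1 f'.2) = sep e f.1.
Proof.
move=> ef nef ff'.
suff H : sep e f'.1 = sep e f.1.
  split=> //; rewrite sep_gactN // -surjective_pairing => ef'; apply: nef.
  by apply: parallel_trans ef' _; exact: parallel_sym.
elim: ff' ef nef => {f f'} [//|f f' ff' IH|f f' k ff' IH1 f'k IH2|f|e1 e2 e3 e4 sq].
- move=> ef' nef'; rewrite IH //; first by rewrite ef' (parallel_label ff').
  by move=> ef; apply: nef'; exact: parallel_trans ef ff'.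
- move=> ef nef; rewrite IH2 ?IH1 //; first by rewrite -(parallel_label ff').
  by move=> ef'; apply: nef; apply: parallel_trans ef' _; exact: parallel_sym.
- move=> ef nef; rewrite [(dinv f).1](_ : _ = gact f.1 f.2) // sep_gactN //.
  by rewrite -surjective_pairing.
- move=> ee1 ne1; case: sq => /salvetti_squareP[_ _ /adjg_neq/eqP ne] [E1 E2 _ _].
  rewrite -E2 sep_gact_label -?E1; last by move=> E; apply: ne; rewrite -ee1 -E.
  by rewrite sep_gactN // -surjective_pairing.
Qed.

(* Two distinct hyperplanes with the same label do not cross. *)
Lemma sep_nested e f u : e.2.1 = f.2.1 -> ~ parallel e f ->
  sep e u = sep e f.1 \/ sep f u = sep f e.1.
Proof.
move=> ef nef; have nfe : ~ parallel f e by move/parallel_sym.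
elim/(@gamma_ind_from f.1): u => [|u x IH]; first by left.
(* An edge that crosses [e] lies in the carrier of [e], which is on a single side of [f], and
   symmetrically. *)
have [ex|nex] := pselect (parallel e (u, x)).
  by right; have [_ <-] := sep_carrier (esym ef) nfe ex.
have [fx|nfx] := pselect (parallel f (u, x)).
  by left; have [_ <-] := sep_carrier ef nef fx.
by rewrite !sep_gactN.
Qed.

Lemma side_fixes_halfspace (g : aut X_CK) e :
  (forall u, sep e u -> autv g u = u) -> fixes_halfspace g.
Proof.
move=> gE; exists [set u | exists p, [/\ edge_path (X := X_CK) (gact e.1 e.2) p,
    endpoint (X := X_CK) (gact e.1 e.2) p = u &
    avoids_hyperplane e p]].
  by exists e, (gact e.1 e.2).
move=> _ [p [pp <- ep]]; apply: gE; move: pp ep.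
have: sep e (gact e.1 e.2) by rewrite sep_tgt.
elim: p (gact _ _) => //= -[g' x] p IH v sv [/= g'v pp] ep.
rewrite /endpoint /=; apply: IH => //; last first.
  by move=> f fp; apply: ep; rewrite inE fp orbT.
rewrite /tgt /= g'v sep_gactN // -g'v; apply: ep; exact: mem_head.
Qed.

(** The sum is twice the coordinate of the midpoint of the edge in its own direction; opposite sides
    of a square differ by a step in another direction. *)
Lemma parallel_mid e f : parallel e f ->
  (ex e.2.1 e.1 + ex e.2.1 (gact e.1 e.2) =
   ex f.2.1 f.1 + ex f.2.1 (gact f.1 f.2))%R.
Proof.
elim=> {e f} [//|e f _ -> //|e f k _ -> _ -> //|e|e1 e2 e3 e4].
  by rewrite /= gactK addrC.
case=> /salvetti_squareP[-> _ /adjg_neq/negPf ne] [<- <- _ _] /=.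
rewrite !ex_gact /exstep /= eqxx eq_sym ne; case: e1.2.2 => /=; lia.
Qed.

Lemma consecutive_not_parallel u x : ~ parallel ((u, x) : dart X_CK) (gact u x, x).
Proof. by move/parallel_mid; rewrite /= !ex_gact /exstep eqxx; case: x.2; lia. Qed.

Lemma opposite_not_parallel u x : ~ parallel ((u, x) : dart X_CK) (u, linv x).
Proof.
by move/parallel_mid; rewrite /= !ex_gact /exstep /= eqxx; case: x.2 => /=; lia.
Qed.

(** * Gluing automorphisms along a hyperplane *)

Section Glue.
Local Open Scope group_scope.

(** Parallel darts occur in both orientations, so fixing the origins fixes both ends of every edge
    dual to the hyperplane. *)
Definition carrier_fixed e (g : aut X_CK) : Prop :=
  forall f, parallel e f -> autv g f.1 = f.1.

Lemma carrier_fixedV e g : carrier_fixed e g -> carrier_fixed e g^-1.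
Proof. by move=> ge f /ge {1}<-; rewrite mulVgv. Qed.

Lemma carrier_fixed_dinv e g : carrier_fixed e g -> carrier_fixed (dinv e) g.
Proof.
move=> ge f ef; apply: ge; apply: parallel_trans ef; exact: parallel_dinv.
Qed.

Lemma carrier_fixed_tgt e g f : carrier_fixed e g -> parallel e f ->
  autv g (gact f.1 f.2) = gact f.1 f.2.
Proof. by move=> ge ef; apply: (ge (dinv f)); exact/parallel_dinvP. Qed.

Lemma carrier_fixed_autd e g : carrier_fixed e g -> autd g e = e.
Proof.
move=> ge; case: e ge => v x ge.
have gv : autv g v = v by apply: (ge (v, x)); exact: parallel_refl.
have := carrier_fixed_tgt ge (parallel_refl _); rewrite autv_gact autdE /= gv.
by move=> /gact_inj ->.
Qed.

Lemma carrier_fixed_sep e g u : carrier_fixed e g -> sep e (autv g u) = sep e u.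
Proof. by move=> ge; rewrite -{1}(carrier_fixed_autd ge) sep_autd. Qed.

Definition glue e (g : aut X_CK) u := if sep e u then autv g u else u.

Lemma glue_lp e g : lpa g -> carrier_fixed e g -> lp (glue e g).
Proof.
move=> lg ge u x; rewrite /glue.
have [ex|nex] := pselect (parallel e (u, x)).
  by rewrite (ge _ ex) (carrier_fixed_tgt ge ex) /= !if_same; left.
by rewrite sep_gactN //; case: ifP => _; [exact: lg|left].
Qed.

Lemma glueK e g : carrier_fixed e g -> cancel (glue e g) (glue e g^-1).
Proof.
move=> ge u; rewrite {2}/glue; case: ifP => eu; rewrite /glue ?eu //.
by rewrite carrier_fixed_sep // eu mulVgv.
Qed.

Lemma glue_exists e g : lpa g -> carrier_fixed e g ->
  exists2 h, lpa h & autv h = glue e g.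
Proof.
move=> lg ge; have geV := carrier_fixedV ge; have lgV := lpaV lg.
have gK : cancel (glue e g^-1) (glue e g) by have := glueK geV; rewrite invgK.
by exists (lp_aut (glue_lp lg ge) (glue_lp lgV geV) (glueK ge) gK) => //;
  exact: glue_lp.
Qed.

End Glue.

(** * Lines, and hyperplanes whose label is a leaf *)

Definition gline (s : generator) u (k : int) : Gamma_CK :=
  match k with
  | Posz n => iter n (fun v => gact v (s, false)) u
  | Negz n => iter n.+1 (fun v => gact v (s, true)) u
  end.

Lemma gline_gact s u k b :
  gact (gline s u k) (s, b) = gline s u (if b then k - 1 else k + 1)%R.
Proof.
suff [E1 E2] : gact (gline s u k) (s, true) = gline s u (k - 1)%R /\
    gact (gline s u k) (s, false) = gline s u (k + 1)%R by case: b.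
case: k => n; split.
- case: n => [//|n]; have -> : (Posz n.+1 - 1 = Posz n)%R by lia.
  exact: (@gactK _ (s, false)).
- by have -> : (Posz n + 1 = Posz n.+1)%R by lia.
- by have -> : (Negz n - 1 = Negz n.+1)%R by lia.
- case: n => [|n].
    by have -> : (Negz 0 + 1 = Posz 0)%R; [lia|exact: (@gactK _ (s, true))].
  have -> : (Negz n.+1 + 1 = Negz n)%R by lia.
  exact: (@gactK _ (s, true)).
Qed.

Lemma gline_ind s u (P : Gamma_CK -> Prop) :
  P u -> (forall v b, P v -> P (gact v (s, b))) -> forall k, P (gline s u k).
Proof. by move=> Pu Ps [n|n]; [elim: n|elim: n => [|n IH]] => //=; auto. Qed.

Lemma ex_gline r s u k : ex r (gline s u k) = (ex r u + (if s == r then k else 0))%R.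
Proof.
case: k => n /=.
  elim: n => [|n IH] /=; first by case: eqP => _; lia.
  by rewrite ex_gact IH /exstep /=; case: eqP => _; lia.
rewrite ex_gact /exstep /=.
suff -> : ex r (iter n (fun v => gact v (s, true)) u) =
    (ex r u + if s == r then - Posz n else 0)%R by case: eqP => _; lia.
elim: n => [|n IH] /=; first by case: eqP => _; lia.
by rewrite ex_gact IH /exstep /=; case: eqP => _; lia.
Qed.

Definition leaf (s t : generator) : Prop := forall r, adjg s r = (r == t).

Lemma leaf_ga : leaf ga gb. Proof. by case. Qed.
Lemma leaf_gd : leaf gd gc. Proof. by case. Qed.

(* The hyperplane of an edge labelled by a leaf of the defining graph is a line. *)
Lemma leaf_parallel s t b v f : leaf s t -> parallel ((v, (s, b)) : dart X_CK) f ->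
  exists k, f = (gline t v k, (s, b)) \/ f = dinv ((gline t v k, (s, b)) : dart X_CK).
Proof.
move=> st; pose x : letter := (s, b).
pose Q (f : dart X_CK) :=
  exists k, f = (gline t v k, x) \/ f = dinv ((gline t v k, x) : dart X_CK).
have adjx y : adjg x.1 y.1 -> y = (t, y.2).
  by case: y => r c; rewrite st /= => /eqP->.
have Qd e : Q e -> Q (dinv e).
  by case=> k [->|->]; exists k; [right|left; rewrite dinvK].
have Qs e1 e2 e3 e4 : @square X_CK e1 e2 e3 e4 -> Q e1 -> Q e3.
  case: e1 e2 e3 e4 => [g1 x1] [g2 x2] [g3 x3] [g4 x4].
  case=> /salvetti_squareP /= [-> _ adj] [<- <- _ _] [k [[-> ex1]|[-> ex1]]].
    rewrite ex1 in adj *; exists (if x2.2 then k - 1 else k + 1)%R; right.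
    by rewrite /= /ck_dinv /= -gline_gact -adjx // gactC.
  rewrite ex1 in adj *; exists (if x2.2 then k - 1 else k + 1)%R; left.
  by rewrite gactK linvK -gline_gact -adjx.
suff H e f' : parallel e f' -> (Q e <-> Q f').
  by move=> /H[+ _]; apply; exists 0%R; left.
elim=> {e f'} [//|e f' _ IH|e f' k _ IH1 _ IH2|e|e1 e2 e3 e4 sq].
- by split; apply IH.
- by split=> [/IH1/IH2|/IH2/IH1].
- by split=> [/Qd|/Qd]; rewrite ?dinvK.
- split; first exact: Qs sq.
  exact: (Qs _ _ _ _ (square_rot (square_rot sq))).
Qed.

Lemma leaf_parallel_org s t v x f : leaf s t -> x.1 = s ->
  parallel ((v, x) : dart X_CK) f -> f.2 = x -> exists k, f.1 = gline t v k.
Proof.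
case: x => s' b st /= -> /(leaf_parallel st)[k [->|->]] /=; first by exists k.
by move=> /linv_free.
Qed.

(** Seen from [gact u x], the fourth corner has only one other possible image, and its exponent of
    [y.1] is wrong when seen from [gact u y]. *)
Lemma lpa_square_fix g u x y : lpa g -> adjg x.1 y.1 -> autv g u = u ->
  autv g (gact u x) = gact u x -> autv g (gact u y) = gact u y ->
  autv g (gact (gact u x) y) = gact (gact u x) y.
Proof.
move=> lg xy gu gx gy; case: (lg (gact u x) y); first by rewrite gx.
rewrite gx {1}gactC // => E.
have {E} : exists z, z.1 = x.1 /\ gact (gact u y) z = gact (gact u x) (linv y).
  rewrite -{}E; case: (lg (gact u y) x) => ->; rewrite gy; first by exists x.
  by exists (linv x).
case=> z [zx] /(congr1 (ex y.1)); rewrite !ex_gact /exstep /= zx eqxx.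
by rewrite (negPf (adjg_neq xy)); case: y.2 => /=; lia.
Qed.

Lemma lpa_linv_fix g u x : lpa g -> autv g u = u ->
  autv g (gact u x) = gact u x -> autv g (gact u (linv x)) = gact u (linv x).
Proof.
move=> lg gu gx; case: (lg u (linv x)); first by rewrite gu.
rewrite gu linvK -gx => /(can_inj (autvK g)) /gact_inj.
by move/linv_free.
Qed.

(** The carrier is a strip of squares along the [t]-line of [v]. Fixedness spreads along it, since
    each new square has three corners known to be fixed. *)
Lemma leaf_carrier_fixed s t v b g : leaf s t -> lpa g -> autv g v = v ->
  autv g (gact v (s, b)) = gact v (s, b) ->
  autv g (gact v (t, false)) = gact v (t, false) ->
  carrier_fixed ((v, (s, b)) : dart X_CK) g.
Proof.
move=> st lg gv gs gt f /(leaf_parallel st)[k].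
pose P u := [/\ autv g u = u, autv g (gact u (s, b)) = gact u (s, b) &
  autv g (gact u (t, false)) = gact u (t, false)].
suff [gk gks _] : P (gline t v k) by case=> ->.
apply: gline_ind => [|u c [gu gus gut]]; first by split.
have guc c' : autv g (gact u (t, c')) = gact u (t, c').
  by case: c' => //; exact: (lpa_linv_fix lg gu gut).
have ad : adjg t s by rewrite adjg_sym st.
split=> //; first by apply: lpa_square_fix.
have := @lpa_linv_fix g (gact u (t, c)) (t, ~~ c) lg (guc _).
have := gactK u (t, c); rewrite /linv /= => -> /(_ gu); rewrite negbK.
by case: c => // _; rewrite (gactK u (t, true)).
Qed.

(** * Generators of Aut^+ *)

Section Stabilizers.
Local Open Scope group_scope.

Definition fixer e (g : aut X_CK) : Prop :=
  lpa g /\ forall u, sep e u -> autv g u = u.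

Lemma fixer_sep e' g u : fixer (dinv e') g -> sep e' (autv g u) = sep e' u.
Proof.
move=> [lg gfix]; have gf w : ~~ sep e' w -> autv g w = w.
  by rewrite -sep_dinv; exact: gfix.
case: (boolP (sep e' u)) => eu; last by rewrite gf // (negPf eu).
apply/negPn/negP => ngu; have /(can_inj (autvK g)) gu := gf _ ngu.
by rewrite gu eu in ngu.
Qed.

(** If [g] moved [u], it would send it across the fixed vertex [gact u x], and two consecutive
    [x]-edges would cross the same hyperplane. *)
Lemma fixer_boundary e' g u x : fixer (dinv e') g ->
  sep e' u -> ~~ sep e' (gact u x) -> autv g u = u.
Proof.
move=> gf eu ew; have [lg gfix] := gf.
have gw : autv g (gact u x) = gact u x by apply: gfix; rewrite sep_dinv.
have cross w y : sep e' (gact w y) != sep e' w -> parallel e' (w, y).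
  rewrite sep_gact; case: (pselect (parallel e' (w, y))) => // np.
  by rewrite (asboolF np) addbF eqxx.
have := lg (gact u x) (linv x); rewrite gactK linvK gw gactK => -[//|gu].
have p1 : parallel e' (u, x) by apply: cross; rewrite eu eqb_id.
have p2 : parallel e' (gact u x, x).
  by apply: cross; rewrite -gu (fixer_sep _ gf) eu eq_sym eqb_id.
case: (@consecutive_not_parallel u x).
by apply: parallel_trans p2; exact: parallel_sym.
Qed.

Lemma fixerV e' g : fixer e' g -> fixer e' g^-1.
Proof.
move=> [lg gf]; split; first exact: lpaV.
by move=> u eu; rewrite -{1}(gf u eu) mulVgv.
Qed.

Lemma glue_fixer e g h : lpa h -> autv h = glue e g -> fixer (dinv e) h.
Proof. by move=> lh hE; split=> // u; rewrite sep_dinv hE /glue => /negPf->. Qed.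

Lemma fixer_split e g : lpa g -> carrier_fixed e g ->
  exists h k, [/\ fixer e h, fixer (dinv e) k & g = h * k].
Proof.
move=> lg ge; have [k lk kE] := glue_exists lg ge.
have [h lh hE] := glue_exists lg (carrier_fixed_dinv ge).
exists h, k; split; last 1 first.
- apply: aut_ext => u; rewrite /= kE hE /glue sep_dinv.
  by case eu: (sep e u); rewrite ?(carrier_fixed_sep _ ge) eu.
- by have := glue_fixer lh hE; rewrite dinvK.
- exact: glue_fixer lk kE.
Qed.

(* The flips of a and b at v are realized by an element that is trivial beyond
   the d-hyperplane next to v; the remaining element fixes the a-hyperplane next
   to v, hence is a product of two elements fixing its sides. *)
Lemma lpa_stab_fixers (M : set (aut X_CK)) :
  (forall g h, M g -> M h -> M (g * h)) ->
  (forall e g, e.2.1 = ga -> fixer e g -> M g) ->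
  forall g v, lpa g -> autv g v = v -> M g.
Proof.
move=> MM Mfix.
have step1 g v : lpa g -> autv g v = v ->
    autv g (gact v (ga, false)) = gact v (ga, false) ->
    autv g (gact v (gb, false)) = gact v (gb, false) -> M g.
  move=> lg gv gva gvb.
  have [h [k [hf kf ->]]] := fixer_split lg (leaf_carrier_fixed leaf_ga lg gv gva gvb).
  by apply: MM; [apply: Mfix hf|apply: Mfix kf].
move=> g v lg gv.
(* The flips of [a] and [b] made by [g] at [v]. As [c] and [d] are not flipped, [phi] fixes the
   [d]-hyperplane next to [v]. *)
pose F s := if s is (ga | gb) then (albl g v (s, false)).2 else false.
pose phi := amove F v v; pose e : dart X_CK := (v, (gd, false)).
have phiv : autv phi v = v by exact: gmove_base.
have phix x : autv phi (gact v x) = gact v (flip F x).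
  by rewrite /= gmove_gact gmove_base.
have fle : carrier_fixed e phi.
  by apply: (leaf_carrier_fixed leaf_gd (amove_lp F v v) phiv); rewrite [LHS]phix.
have fled : carrier_fixed (dinv e) phi := carrier_fixed_dinv fle.
have [h lh hE] := glue_exists (amove_lp F v v) fled.
have hid u : sep e u -> autv h u = u by rewrite hE /glue sep_dinv => ->.
have hphi u : ~~ sep e u -> autv h u = autv phi u.
  by rewrite hE /glue sep_dinv => ->.
have ev : sep e v = false by exact: (sep_org e).
have evd : sep e (gact v (gd, false)) by exact: (sep_tgt e).
(* [step1] applies at the vertex just beyond the [d]-hyperplane: the [a]- and [b]-edges there do not
   cross back. *)
have Mh : M h.
  by apply: (step1 h (gact v (gd, false)) lh); apply: hid => //;
    rewrite sep_gact_label.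
have hv : autv h v = v by rewrite hphi ?ev.
have gE s : s \in [:: ga; gb] ->
    autv (h^-1 * g) (gact v (s, false)) = gact v (s, false).
  move=> sab; rewrite [LHS](_ : _ = autv h^-1 (autv g (gact v (s, false)))) //.
  suff -> : autv g (gact v (s, false)) = autv h (gact v (s, false)) by exact: mulVgv.
  have ens : sep e (gact v (s, false)) = false.
    by rewrite sep_gact_label //; move: sab => + sd; rewrite /= in sd; rewrite sd.
  rewrite hphi ?ens // phix autv_gact gv; congr gact.
  have := lpaE g; case=> /(_ lg) /(_ v (s, false)) /= lE _.
  rewrite [LHS]surjective_pairing lE /flip /F /=.
  by move: sab; rewrite !inE => /orP[] /eqP->.
have lhg : lpa (h^-1 * g) by apply: lpaM => //; exact: lpaV.
have -> : g = h * (h^-1 * g) by rewrite monoid.mulVKg.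
apply: MM => //; apply: (step1 _ v) => //; last 2 first.
- exact: gE.
- exact: gE.
- by rewrite [LHS](_ : _ = autv h^-1 (autv g v)) // gv -{1}hv mulVgv.
Qed.

Lemma autplus_subgroup : subgroup (autplus X_CK).
Proof.
split=> [S [[S1 _ _] _] //|x y xA yA S SG|x xA S SG].
  by have [[_ + _] _] := SG; apply; [exact: xA|exact: yA].
by have [[_ _ +] _] := SG; apply; exact: xA.
Qed.

Lemma fixer_autplus e g : fixer e g -> autplus X_CK g.
Proof. by move=> [_ ge]; apply: sub_gen_smallest; exact: side_fixes_halfspace ge. Qed.

Lemma lpa_stab_autplus g v : lpa g -> autv g v = v -> autplus X_CK g.
Proof.
have [_ AM _] := autplus_subgroup; apply: lpa_stab_fixers => // e h _.
exact: fixer_autplus.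
Qed.

Lemma autplus_fixers (N : set (aut X_CK)) : subgroup N ->
  (forall e g, e.2.1 = ga -> fixer e g -> N g) -> autplus X_CK `<=` N.
Proof.
move=> sN Nfix; apply: smallest_sub => // g /fixes_halfspace_lp[lg [v gv]].
by have [_ NM _] := sN; exact: lpa_stab_fixers gv.
Qed.

End Stabilizers.

(** * Simplicity *)

Section Swindle.
Local Open Scope group_scope.
Variables (e : dart X_CK) (n : aut X_CK).
Hypothesis ln : lpa n.

Let m := autv n^-1.

(* The half-spaces sep e, n (sep e), n^2 (sep e), ... are pairwise disjoint. *)
Hypothesis disj : forall i j u, sep e (iter i m u) -> sep e (iter j m u) -> i = j.

Let mK : cancel (autv n) m. Proof. exact: mulVgv. Qed.
Let mVK : cancel m (autv n). Proof. exact: mulgVv. Qed.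

Lemma iterVK j : cancel (iter j m) (iter j (autv n)).
Proof. by elim: j => // j IH u; rewrite iterSr iterS mVK IH. Qed.

Lemma iterK j : cancel (iter j (autv n)) (iter j m).
Proof. by elim: j => // j IH u; rewrite iterSr iterS mK IH. Qed.

Definition swidx u : option nat :=
  if pselect (exists j, sep e (iter j m u)) is left ex then Some (ex_minn ex)
  else None.

Lemma swidxP j u : swidx u = Some j <-> sep e (iter j m u).
Proof.
rewrite /swidx; case: pselect => [ex|nex]; last first.
  by split=> // ej; case: nex; exists j.
case: ex_minnP => i ei _; split=> [[<-] //|ej].
by congr Some; exact: disj ei ej.
Qed.

(* n^j g n^-j on the j-th translate n^j (sep e), the identity elsewhere. *)
Definition swin (g : aut X_CK) u : Gamma_CK :=
  if swidx u is Some j then iter j (autv n) (autv g (iter j m u)) else u.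

Lemma swin_idx g u : fixer (dinv e) g -> swidx (swin g u) = swidx u.
Proof.
move=> gf; rewrite /swin; case E: (swidx u) => [j|] //.
apply/swidxP; rewrite iterK (fixer_sep _ gf); exact/swidxP.
Qed.

Lemma swinK g : fixer (dinv e) g -> cancel (swin g) (swin g^-1).
Proof.
move=> gf u; rewrite {1}/swin (swin_idx _ gf) /swin.
by case: (swidx u) => [j|] //; rewrite iterK mulVgv iterVK.
Qed.

Lemma swin_boundary g u x j : fixer (dinv e) g -> swidx u = Some j ->
  swidx (gact u x) <> Some j -> swin g u = u.
Proof.
move=> gf uj wj; rewrite /swin uj.
have lm : lp (iter j m) by apply: lp_iter; exact: lpaV.
have ju : sep e (iter j m u) by exact/swidxP.
have jw : ~~ sep e (iter j m (gact u x)) by apply/negP => /swidxP.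
suff -> : autv g (iter j m u) = iter j m u by exact: iterVK.
by case: (lm u x) jw => -> jw; exact: fixer_boundary gf ju jw.
Qed.

(** An edge whose ends have the same index is moved by a label preserving map; otherwise both ends
    are fixed, by [swin_boundary]. *)
Lemma swin_lp g : fixer (dinv e) g -> lp (swin g).
Proof.
move=> gf u x; have [uw|uw] := pselect (swidx u = swidx (gact u x)).
  rewrite /swin -uw; case: (swidx u) => [j|]; last by left.
  have lm : lp (iter j m) by apply: lp_iter; exact: lpaV.
  have lj : lp (iter j (autv n)) by exact: lp_iter.
  exact: (lp_comp lj (lp_comp (proj1 gf) lm)).
have -> : swin g u = u.
  case E: (swidx u) => [j|]; last by rewrite /swin E.
  by apply: (swin_boundary gf E (x := x)) => E'; apply: uw; rewrite E E'.
have -> : swin g (gact u x) = gact u x; last by left.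
case E: (swidx (gact u x)) => [j|]; last by rewrite /swin E.
by apply: (swin_boundary gf E (x := linv x)); rewrite gactK => E'; apply: uw; rewrite E E'.
Qed.

(* The infinite product k of the n^j g n^-j satisfies k = g (n k n^-1). *)
Lemma swindle g : fixer (dinv e) g ->
  exists2 k, autplus X_CK k & g = k * n * k^-1 * n^-1.
Proof.
move=> gf; have gfV := fixerV gf.
have swKV : cancel (swin g^-1) (swin g) by have := swinK gfV; rewrite invgK.
pose k := lp_aut (swin_lp gf) (swin_lp gfV) (swinK gf) swKV.
have kP : autplus X_CK k.
  (* The terminus of [e] has index 0 and its neighbour [e.1] does not, so [k] fixes it. *)
  apply: (@lpa_stab_autplus k (gact e.1 e.2)); first exact: swin_lp.
  have i0 : swidx (gact e.1 e.2) = Some 0 by apply/swidxP; exact: sep_tgt.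
  apply: (swin_boundary gf i0 (x := linv e.2)); rewrite gactK => /swidxP /=.
  by rewrite sep_org.
exists k => //; suff kE : k = g * (n * k * n^-1).
  by rewrite {1}kE -!mulgA monoid.mulKg monoid.mulVKg mulgV mulg1.
apply: aut_ext => u; rewrite [RHS](_ : _ = autv g (autv n (swin g (m u)))) //.
have gid v : ~~ sep e v -> autv g v = v.
  by have [_ gfix] := gf; rewrite -sep_dinv; exact: gfix.
(* On the translate of index 0 only [g] acts; on a later one the conjugate of [k] by [n] reproduces
   [k] and [g] is trivial; elsewhere nothing moves. *)
rewrite [LHS](_ : _ = swin g u) //; case E: (swidx u) => [[|j]|].
- have -> : swin g (m u) = m u.
    rewrite /swin; case E': (swidx (m u)) => [i|] //.
    have : swidx u = Some i.+1 by apply/swidxP; rewrite iterSr; exact/swidxP.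
    by rewrite E.
  by rewrite /swin E /= mVK.
- have E' : swidx (m u) = Some j by apply/swidxP; rewrite -iterSr; exact/swidxP.
  have -> : autv n (swin g (m u)) = swin g u by rewrite /swin E E' /= -iterSr.
  by rewrite gid //; apply/negP => /(@swidxP 0); rewrite (swin_idx _ gf) E.
- have -> : swin g (m u) = m u.
    rewrite /swin; case E': (swidx (m u)) => [i|] //.
    have : swidx u = Some i.+1 by apply/swidxP; rewrite iterSr; exact/swidxP.
    by rewrite E.
  rewrite mVK gid /swin ?E //.
  by apply/negP => /(@swidxP 0); rewrite E.
Qed.

End Swindle.

Lemma sep_gline e s u k : s <> e.2.1 -> sep e (gline s u k) = sep e u.
Proof.
move=> se; apply: (@gline_ind s u (fun w => sep e w = sep e u)) => // w b IH.
by rewrite sep_gact_label.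
Qed.

Section Comb.
Variables (v : Gamma_CK) (x : letter).
Hypothesis xa : x.1 = ga.

Definition comb (i : nat) : dart X_CK := (gline gd v i, x).

(** An [a]-hyperplane runs along a [b]-line, on which the exponent of [d] is constant. *)
Lemma comb_not_parallel i j : i != j -> ~ parallel (comb i) (comb j).
Proof.
move=> ij /(leaf_parallel_org leaf_ga xa)[//|k E].
have {E} /(congr1 (ex gd)) : gline gd v j = gline gb (gline gd v i) k := E.
by rewrite !ex_gline /=; move: ij; lia.
Qed.

Lemma comb_base e i : e.2.1 = ga -> sep e (comb i).1 = sep e v.
Proof. by move=> ea; rewrite sep_gline // ea. Qed.

(** The base [d]-line crosses no [a]-hyperplane, so it avoids every side [sep (comb i)];
    [sep_nested] then makes these sides disjoint. *)
Lemma comb_disjoint i j u : i != j -> sep (comb i) u -> ~~ sep (comb j) u.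
Proof.
move=> ij iu; case: (sep_nested u _ (comb_not_parallel ij)) => // [|->].
  by rewrite iu comb_base // -(comb_base i) // sep_org.
by rewrite comb_base // -(comb_base j) // sep_org.
Qed.

End Comb.

Section Simplicity.
Local Open Scope group_scope.

Lemma lpa_dart g u s b : lpa g -> exists c, autd g (u, (s, b)) = (autv g u, (s, c)).
Proof.
move=> /lpaE lg; exists (albl g u (s, b)).2; rewrite autdE; congr pair.
by rewrite [LHS]surjective_pairing lg.
Qed.

Lemma autd_label g e : lpa g -> (autd g e).2.1 = e.2.1.
Proof. by move=> /lpaE lg; case: e => u x; rewrite autdE lg. Qed.

(* An element moving no vertex across an a-hyperplane preserves every
   a-hyperplane, hence the d-hyperplanes too; these meet at single vertices. *)
Lemma moved_across g : lpa g -> g <> 1 ->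
  exists e v, e.2.1 = ga /\ sep e v != sep e (autv g v).
Proof.
move=> lg g1; apply: contrapT => H; apply: g1.
have sepE e v : e.2.1 = ga -> sep e (autv g v) = sep e v.
  move=> ea; apply: contrapT => /eqP ne; apply: H; exists e, v; split=> //.
  by rewrite eq_sym.
(* The [a]-hyperplane at [v] is preserved, so [g v] stays on its carrier, a strip along a
   [b]-line. *)
have line v : exists k, autv g v = gline gb v k \/
    exists b, autv g v = gact (gline gb v k) (ga, b).
  have [c E] := lpa_dart v ga false lg.
  have : parallel ((v, (ga, false)) : dart X_CK) (autd g (v, (ga, false))).
    rewrite E; apply: contrapT => /sep_gactN.
    have -> : gact (autv g v) (ga, c) = autv g (gact v (ga, false)).
      by rewrite autv_gact /albl E.
    by rewrite !sepE // sep_gact asboolT ?addbT; [case: (sep _ _)|exact: parallel_refl].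
  rewrite E => /(leaf_parallel leaf_ga)[k [[-> _]|[-> _]]]; exists k; first by left.
  by right; exists false.
apply: aut_ext => v /=.
pose e : dart X_CK := (v, (gd, false)).
have [c E] := lpa_dart v gd false lg.
have gvd : autv g (gact v (gd, false)) = gact (autv g v) (gd, c).
  by rewrite autv_gact /albl E.
have sepL w : sep e (autv g w) = sep e w.
  by have [k [->|[b ->]]] := line w; rewrite ?sep_gact_label // sep_gline.
have : parallel e (autv g v, (gd, c)).
  apply: contrapT => /sep_gactN; rewrite -gvd !sepL.
  by rewrite (sep_org e) (sep_tgt e).
move=> /(leaf_parallel leaf_gd)[k' K'].
(* The preserved [d]-hyperplane runs along a [c]-line, so [g v] has the exponents of [a] and [b] of
   [v]; on the strip this leaves only [v]. *)
have exab s : s \in [:: ga; gb] -> ex s (autv g v) = ex s v.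
  by rewrite !inE => /orP[] /eqP->; case: K' => -[-> _];
    rewrite ?ex_gact ex_gline /exstep /= addr0 ?addr0.
have := exab ga isT; have := exab gb isT.
have [k [->|[b ->]]] := line v; rewrite ?ex_gact !ex_gline /exstep /=.
  by move=> kb _; have -> : k = 0%R by lia.
by case: b; lia.
Qed.

Variable N : set (aut X_CK).
Hypothesis normalN : normal_in N (autplus X_CK).

Let N_lp n : N n -> lpa n.
Proof. by have [_ + _] := normalN => /[apply] /autplus_lp. Qed.

Definition displaced e : Prop :=
  exists2 n, N n & forall u, sep e u -> ~~ sep e (autv n u).

Lemma displacedS e k g : autplus X_CK g ->
  (forall u, sep e u -> sep k (autv g u)) -> displaced k -> displaced e.
Proof.
move=> Gg ek [n Nn nk]; have [_ _ /(_ n g Nn Gg) Ng] := normalN.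
exists (g^-1 * n * g) => // u eu; apply/negP => /ek.
rewrite [autv g _](_ : _ = autv g (autv g^-1 (autv n (autv g u)))) // mulgVv.
exact/negP/nk/ek.
Qed.

Definition reflection u : aut X_CK := amove (fun=> true) u u.

Lemma reflection_autplus u : autplus X_CK (reflection u).
Proof.
by apply: (@lpa_stab_autplus _ u); [exact: amove_lp|exact: gmove_base].
Qed.

(** The reflection maps [e] to the opposite edge at its origin. The two hyperplanes are distinct, so
    their sides away from that origin are disjoint. *)
Lemma reflection_sep e u : sep e u -> ~~ sep e (autv (reflection e.1) u).
Proof.
move=> eu; set r := reflection _; set w := autv r u.
pose e' : dart X_CK := (e.1, linv e.2).
have re : autd r e = e'.
  case: e @r @w @e' {eu} => v x r w e'; rewrite autdE.
  have rv : autv r v = v by exact: gmove_base.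
  rewrite rv; congr pair; apply: (@gact_inj v); rewrite -{1}rv -autv_gact /=.
  by rewrite gmove_gact gmove_base /flip /linv addbT.
have e'w : sep e' w by rewrite -re sep_autd.
have nee' : ~ parallel e e'.
  by have := @opposite_not_parallel e.1 e.2; rewrite -surjective_pairing.
case: (sep_nested w _ nee') => // [->|]; first by rewrite (sep_org e).
by rewrite e'w (sep_org e').
Qed.

(* Reflections of Aut^+ fixing a vertex next to a hyperplane map one of its sides
   into the other one, so that any half-space can be moved into any other one. *)
Lemma displaced_all (k e : dart X_CK) : k.2.1 = ga -> e.2.1 = ga -> displaced k -> displaced e.
Proof.
move=> ka ea dk; pose r := reflection (gact k.1 k.2).
have rP u : ~~ sep k u -> sep k (autv r u).
  by rewrite -sep_dinv => /reflection_sep; rewrite sep_dinv negbK.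
have [_ GM _] := autplus_subgroup.
have [G1 _ _] := autplus_subgroup.
suff [g Gg [c gc]] : exists2 g, autplus X_CK g &
    exists c, forall u, sep e u -> sep k (autv g u) = c.
  case: c gc => gc; first by apply: (displacedS Gg _ dk) => u /gc.
  have Grg : autplus X_CK (r * g) by apply: GM Gg; exact: reflection_autplus.
  by apply: (displacedS Grg _ dk) => u /gc /negbT /rP.
have [ek|nek] := pselect (parallel k e).
  exists 1 => //; exists (~~ sep k e.1) => u; rewrite (sep_parallel _ ek) /=.
  by case: (sep k u); case: (sep k e.1).
have ke : k.2.1 = e.2.1 by rewrite ka ea.
have nest u := sep_nested u ke nek.
(* If the origin of [k] is not in the side of [e], that side does not meet both sides of [k];
   otherwise the reflection at the origin of [e] first moves it to the other side of [e]. *)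
case E: (sep e k.1); last first.
  exists 1 => //; exists (sep k e.1) => u eu /=; case: (nest u) => //.
  by rewrite E eu.
exists (reflection e.1); first exact: reflection_autplus.
exists (sep k e.1) => u /reflection_sep nr; case: (nest (autv (reflection e.1) u)) => // E'.
by move: nr; rewrite E' E.
Qed.

(* Of three disjoint half-spaces along a d-line through v, the vertices n v and
   n^-1 v lie in at most two; the third one is displaced by n. *)
Lemma displaced_exists : N <> [set 1] -> exists2 k : dart X_CK, k.2.1 = ga & displaced k.
Proof.
move=> N1; have [[N_1 _ _] _ _] := normalN.
have [n [Nn n1]] : exists n, N n /\ n <> 1.
  apply: contrapT => H; apply: N1; apply/seteqP; split=> [n Nn|_ ->//].
  by apply: contrapT => n1; apply: H; exists n.
have ln := N_lp Nn; have lnV := lpaV ln.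
have [e [v [ea env]]] := moved_across ln n1.
pose k i := comb v (ga, false) i.
have [i [i1 i2]] : exists i, ~~ sep (k i) (autv n v) /\ ~~ sep (k i) (autv n^-1 v).
  have dis (i j : nat) u : i != j -> ~~ (sep (k i) u && sep (k j) u).
    by move=> ij; apply/negP => /andP[iu]; exact/negP/(comb_disjoint _ ij).
  move: (dis 0%N 1%N (autv n v) isT) (dis 0%N 2%N (autv n v) isT) (dis 1%N 2%N (autv n v) isT).
  move: (dis 0%N 1%N (autv n^-1 v) isT) (dis 0%N 2%N (autv n^-1 v) isT)
    (dis 1%N 2%N (autv n^-1 v) isT) => {dis}.
  move=> a1 a2 a3 b1 b2 b3; apply: contrapT => H.
  have {}H i : sep (k i) (autv n v) || sep (k i) (autv n^-1 v).
    apply: contrapT => /negP; rewrite negb_or => /andP[? ?]; apply: H.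
    by exists i.
  move: (H 0%N) (H 1%N) (H 2%N) a1 a2 a3 b1 b2 b3 => {H}.
  by do 6!case: (sep _ _) => //=.
have kbase e' : e'.2.1 = ga -> sep e' (k i).1 = sep e' v by exact: comb_base.
have move_sep e' g u : sep e' (autv g u) = sep (autd g^-1 e') u.
  by rewrite -[LHS](congr1 (sep^~ _) (autVdK g e')) sep_autd.
have nbase g e' : lpa g -> e'.2.1 = ga -> sep e' (autv g (k i).1) = sep e' (autv g v).
  move=> lg e'a; rewrite !move_sep kbase // autd_label //; exact: lpaV.
exists (k i) => //; exists n => // u ku.
pose k' := autd n (k i).
have k'1 : k'.1 = autv n (k i).1 by exact: (aut_org n (k i)).
have k'n : sep k' (autv n u) by rewrite sep_autd.
have kk' : sep (k i) k'.1 = false by rewrite k'1 nbase // (negPf i1).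
have kk'a : (k i).2.1 = k'.2.1 by rewrite autd_label.
have k'k : sep k' (k i).1 = false.
  by rewrite kbase -?kk'a // -[v](mulgVv n) sep_autd (negPf i2).
(* If the hyperplanes of [k i] and its image differ, nesting makes their sides disjoint. If they
   coincide, [e] cannot separate [v] from [n v], against its choice. *)
have [par|npar] := pselect (parallel (k i) k'); last first.
  have [->|] := sep_nested (autv n u) kk'a npar; first by rewrite kk'.
  by rewrite k'n k'k.
case/eqP: env; rewrite -kbase // -nbase // -k'1.
have [ke|nke] := pselect (parallel (k i) e).
  by rewrite !(sep_parallel _ ke) kk' (sep_org (k i)).
by have [->] := @sep_carrier e (k i) k' ea (fun H => nke (parallel_sym H)) par.
Qed.

(* Ping-pong with three disjoint half-spaces along a d-line: n maps the
   half-spaces numbered 0 and 1 into the one numbered 1. *)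
Lemma normal_fixer e g : N <> [set 1] -> e.2.1 = ga -> fixer e g -> N g.
Proof.
move=> /displaced_exists[k0 k0a dk0] ea gf.
have [[N_1 NM NV] NG Nconj] := normalN.
have da (k : dart X_CK) : k.2.1 = ga -> displaced k by move=> ka; exact: displaced_all dk0.
have e0 : comb (dinv e).1 (dinv e).2 0%N = dinv e by rewrite [RHS]surjective_pairing.
pose k i := comb (dinv e).1 (dinv e).2 i.
have dis (i j : nat) u : i != j -> sep (k i) u -> ~~ sep (k j) u by exact: comb_disjoint.
have [n2 N2 n2P] : displaced (dinv (k 2%N)) by exact: da.
have [n1 N1 n1P] : displaced (dinv (k 1%N)) by exact: da.
(* [n2] sends the complement of half-space 2 into half-space 2, which [n1] sends into half-space
   1. *)
pose n := n1 * n2; have Nn : N n by exact: NM.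
have nP u : ~~ sep (k 2%N) u -> sep (k 1%N) (autv n u).
  move=> k2u; have k2n : sep (k 2%N) (autv n2 u).
    by rewrite -[sep _ _]negbK -sep_dinv; apply: n2P; rewrite sep_dinv.
  rewrite -[sep _ _]negbK -sep_dinv; apply: n1P; rewrite sep_dinv.
  exact: (dis 2%N 1%N).
have iterP j u : sep (k 0%N) u -> sep (k 1%N) (iter j.+1 (autv n) u).
  move=> k0u; elim: j => [|j IH]; first by apply: nP; exact: (dis 0%N 2%N).
  by rewrite iterS; apply: nP; exact: (dis 1%N 2%N).
have ln := N_lp Nn.
have far i j u : i < j -> sep (k 0%N) (iter i (autv n^-1) u) ->
    sep (k 0%N) (iter j (autv n^-1) u) -> False.
  move=> ij ei ej; have /(iterP (j - i).-1) := ej.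
  rewrite prednK ?subn_gt0 // -{2}(subnK (ltnW ij)) iterD iterVK.
  by apply/negP; exact: (dis 0%N 1%N).
have disj i j u : sep (dinv e) (iter i (autv n^-1) u) ->
    sep (dinv e) (iter j (autv n^-1) u) -> i = j.
  rewrite -e0 => ei ej; case: (ltngtP i j) => // ij; exfalso.
    exact: far ij ei ej.
  exact: far ij ej ei.
have [h Gh ->] : exists2 h, autplus X_CK h & g = h * n * h^-1 * n^-1.
  by apply: (swindle ln disj); rewrite dinvK.
apply: NM; last exact: NV.
have [_ _ GV] := autplus_subgroup.
by rewrite -{1}[h]invgK; apply: Nconj => //; exact: GV.
Qed.

End Simplicity.

(** * Topology *)

Lemma ultra_or (T : Type) (F : set_system T) (A B C : set T) :
  UltraFilter F -> F A -> (forall t, A t -> B t \/ C t) -> F B \/ F C.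
Proof.
move=> UF FA ABC; have [|FnB] := in_ultra_setVsetC B UF; first by left.
by right; apply: filterS2 FA FnB => t /ABC[].
Qed.

Section AutTopology.
Variable R : realType.
Local Notation AutT := (aut_top R X_CK).
Local Notation Real := (@realization R X_CK).

Lemma open_neq0 (u : Gamma_CK) : open [set w : Real | set_val w u != 0%R].
Proof.
have c1 : continuous (set_val : Real -> {ptws vert X_CK -> R}).
  exact: initial_continuous.
have c2 : continuous (fun f : {ptws vert X_CK -> R} => f u) by exact: proj_continuous.
have -> : [set w : Real | set_val w u != 0%R] =
    set_val @^-1` ((fun f : {ptws vert X_CK -> R} => f u) @^-1` ~` [set 0%R]).
  by apply/seteqP; split=> w /= /eqP.
apply: open_comp => [w _|]; first exact: c1.
apply: open_comp => [w _|]; first exact: c2.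
apply: closed_openC; apply: accessible_closed_set1; apply: hausdorff_accessible.
exact: norm_hausdorff.
Qed.

(** A subbasic set: the compact set is the vertex [u], the open set consists of the points with
    nonzero weight at [v]. *)
Lemma open_autv (u v : Gamma_CK) : open [set g : AutT | autv g u = v].
Proof.
pose w : Real := SigSub (mem_set (or_introl (ex_intro _ u erefl) : Real (@vpoint R X_CK u))).
have oO : open [set f : {compact-open, Real -> Real} |
    f @` [set w] `<=` [set z : Real | set_val z v != 0%R]].
  by apply: compact_open_open; [exact: compact_set1|exact: open_neq0].
exists [set f : {compact-open, Real -> Real} |
    f @` [set w] `<=` [set z : Real | set_val z v != 0%R]] => //.
have E g : set_val (realize g w) v = ((v == autv g u)%:R)%R.
  by have := congr1 (fun z : vert X_CK -> R => z v) (@vpoint_aut R X_CK g u).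
apply/seteqP; split=> g /=.
  move=> /(_ (realize g w)) H; have := H (ex_intro2 _ _ w erefl erefl).
  by rewrite /= E; have [->|_] := eqVneq v (autv g u); rewrite ?eqxx.
by move=> gu _ [_ -> <-] /=; rewrite E gu eqxx oner_eq0.
Qed.

Lemma open_autv_set (u : Gamma_CK) (P : set Gamma_CK) :
  open [set g : AutT | P (autv g u)].
Proof.
have -> : [set g : AutT | P (autv g u)] =
    \bigcup_(v in P) [set g : AutT | autv g u = v].
  apply/seteqP; split=> g /=; first by exists (autv g u).
  by case=> v Pv /= ->.
by apply: bigcup_open => v _; exact: open_autv.
Qed.

Definition letters : seq letter :=
  [seq (s, b) | s <- [:: ga; gb; gc; gd], b <- [:: false; true]].

Lemma mem_letters x : x \in letters.
Proof. by case: x => -[] []. Qed.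

Definition ball2 (u : Gamma_CK) : seq Gamma_CK :=
  u :: [seq gact u x | x <- letters] ++
  flatten [seq [seq gact (gact u x) y | y <- letters] | x <- letters].

Lemma ball2_0 u : u \in ball2 u. Proof. exact: mem_head. Qed.

Lemma ball2_1 u x : gact u x \in ball2 u.
Proof. by rewrite inE mem_cat map_f ?orbT // mem_letters. Qed.

Lemma ball2_2 u x y : gact (gact u x) y \in ball2 u.
Proof.
rewrite inE mem_cat; apply/orP; right; apply/orP; right.
apply/flattenP; exists [seq gact (gact u x) y | y <- letters].
  by apply: (map_f (fun x => [seq gact (gact u x) y | y <- letters])); exact: mem_letters.
by apply: map_f; exact: mem_letters.
Qed.

Lemma vpoint_neq0 v u : (@vpoint R X_CK v u != 0)%R -> u = v.
Proof. by rewrite /vpoint; have [->//|_] := eqVneq u v; rewrite eqxx. Qed.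

Lemma epoint_neq0 e t u : (@epoint R X_CK e t u != 0)%R -> u = org e \/ u = tgt e.
Proof.
rewrite /epoint; have [/vpoint_neq0|] := boolP (@vpoint R X_CK (org e) u != 0)%R; first by left.
rewrite negbK => /eqP->; have [/vpoint_neq0|] := boolP (@vpoint R X_CK (tgt e) u != 0)%R.
  by right.
by rewrite negbK => /eqP->; rewrite !mulr0 addr0 eqxx.
Qed.

Lemma realization_near (w : vert X_CK -> R) u v : Real w ->
  (w u != 0)%R -> (w v != 0)%R -> v \in ball2 u.
Proof.
have back z x : z \in ball2 (gact z x) by rewrite -{1}(gactK z x) ball2_1.
have near1 (e : dart X_CK) a b : (a = org e \/ a = tgt e) ->
    (b = org e \/ b = tgt e) -> b \in ball2 a.
  case: e => g x; rewrite /tgt /=; move=> [->|->] [->|->];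
  by rewrite ?ball2_0 ?ball2_1 ?back.
case=> [[z ->]|[[e [t [_ _ ->]]]|]].
- by move=> /vpoint_neq0-> /vpoint_neq0->; exact: ball2_0.
- by move=> /epoint_neq0 ue /epoint_neq0 ve; exact: near1 ue ve.
case=> e1 [e2 [e3 [e4 [s [t [sq _ _ ->]]]]]].
have supp z : (@spoint R X_CK e1 e3 s t z != 0)%R ->
    (z = org e1 \/ z = tgt e1) \/ (z = org e3 \/ z = tgt e3).
  rewrite /spoint; have [/epoint_neq0|] := boolP (@epoint R X_CK e1 s z != 0)%R; first by left.
  rewrite negbK => /eqP->; have [|] := boolP (@epoint R X_CK (dinv e3) s z != 0)%R.
    by move=> /epoint_neq0; rewrite /tgt dinvK; tauto.
  by rewrite negbK => /eqP->; rewrite !mulr0 addr0 eqxx.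
case: e1 e2 e3 e4 sq supp => [g1 x1] [g2 x2] [g3 x3] [g4 x4].
case=> /salvetti_squareP /= [-> -> _] [<- <- <- DA] {g2 g3 g4 x3 x4}.
rewrite /tgt /= => supp.
set B := gact g1 x1 in DA supp *; set C := gact B x2 in DA supp *.
set D := gact C (linv x1) in DA supp *.
have BA : gact B (linv x1) = g1 by exact: gactK.
have CB : gact C (linv x2) = B by exact: gactK.
have DC : gact D x1 = C by exact: gactKV.
have AD : gact g1 x2 = D by rewrite -DA gactKV.
have cA z : [\/ z = g1, z = B, z = C | z = D] -> z \in ball2 g1.
  by case=> ->; rewrite ?ball2_0 ?ball2_1 ?ball2_2 // -AD ball2_1.
have cB z : [\/ z = g1, z = B, z = C | z = D] -> z \in ball2 B.
  by case=> ->; rewrite ?ball2_0 ?ball2_1 ?ball2_2 // -BA ball2_1.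
have cC z : [\/ z = g1, z = B, z = C | z = D] -> z \in ball2 C.
  by case=> ->; rewrite ?ball2_0 ?ball2_1 // ?back // -DA ball2_2.
have cD z : [\/ z = g1, z = B, z = C | z = D] -> z \in ball2 D.
  by case=> ->; rewrite ?ball2_0 ?back // -?DA ?ball2_1 // -CB -DC ball2_2.
move=> /supp us /supp vs.
have {}vs : [\/ v = g1, v = B, v = C | v = D].
  by move: vs; rewrite -/D; case=> -[->|->]; [apply: Or41|apply: Or42|apply: Or43|apply: Or44].
by case: us => -[->|->]; auto.
Qed.

(* A point of the realization determines, through its supporting cell, a finite
   set of vertices outside of which an automorphism does not matter. *)
Lemma realize_agree (g h : AutT) (w : Real) u : (set_val w u != 0)%R ->
  (forall v, v \in ball2 u -> autv h v = autv g v) -> realize h w = realize g w.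
Proof.
move=> wu hg; apply: val_inj; apply/funext => z.
suff : set_val w (autVv h z) = set_val w (autVv g z) by [].
have near v : (set_val w v != 0)%R -> autv h v = autv g v.
  by move=> wv; apply: hg; exact: realization_near (set_valP w) wu wv.
have [|] := boolP (set_val w (autVv h z) != 0)%R.
  by move=> /near; rewrite autVvK => E; rewrite {2}E autvK.
rewrite negbK => /eqP hz; rewrite hz.
have [|] := boolP (set_val w (autVv g z) != 0)%R; last by rewrite negbK => /eqP->.
by move=> wz; have := near _ wz; rewrite autVvK => E; rewrite -{1}E autvK in hz;
  rewrite hz.
Qed.

Lemma epoint_sum e (t : R) : (0 <= t)%R -> (t <= 1)%R ->
  exists u, (0 < @epoint R X_CK e t u)%R.
Proof.
move=> t0 t1; have vp v u : (0 <= @vpoint R X_CK v u)%R by rewrite /vpoint ler0n.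
have v1 v : @vpoint R X_CK v v = 1%R by rewrite /vpoint eqxx.
have [t_lt1|] := ltrP t 1; last first.
  move=> t1'; exists (tgt e); rewrite /epoint v1 mulr1.
  by apply: ltr_wpDl; [rewrite mulr_ge0 // subr_ge0|exact: lt_le_trans ltr01 t1'].
exists (org e); rewrite /epoint v1 mulr1; apply: ltr_wpDr; last by rewrite subr_gt0.
by rewrite mulr_ge0.
Qed.

Lemma epoint_ge0 e (t : R) u : (0 <= t)%R -> (t <= 1)%R ->
  (0 <= @epoint R X_CK e t u)%R.
Proof.
by move=> t0 t1; rewrite /epoint addr_ge0 // mulr_ge0 ?subr_ge0.
Qed.

Lemma realization_neq0 (w : vert X_CK -> R) : Real w -> exists u, (w u != 0)%R.
Proof.
case=> [[z ->]|[[e [t [t0 t1 ->]]]|]].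
- by exists z; rewrite /vpoint eqxx oner_eq0.
- by have [u u0] := epoint_sum e t0 t1; exists u; rewrite gt_eqF.
case=> e1 [e2 [e3 [e4 [s [t [_ [s0 s1] [t0 t1] ->]]]]]].
have [t_lt1|t1'] := ltrP t 1.
  have [u u0] := epoint_sum e1 s0 s1; exists u; rewrite /spoint gt_eqF //.
  by apply: ltr_wpDr; [rewrite mulr_ge0 // epoint_ge0|rewrite mulr_gt0 // subr_gt0].
have [u u0] := epoint_sum (dinv e3) s0 s1; exists u; rewrite /spoint gt_eqF //.
apply: ltr_wpDl; first by rewrite mulr_ge0 ?epoint_ge0 // subr_ge0.
by rewrite mulr_gt0 //; exact: lt_le_trans ltr01 t1'.
Qed.

Definition agree (F : seq Gamma_CK) (g : AutT) : set AutT :=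
  [set h : AutT | forall u, u \in F -> autv h u = autv g u].

Definition agree_filter (g : AutT) : set_system AutT :=
  [set S | exists F, agree F g `<=` S].

Lemma agree_filter_filter g : Filter (agree_filter g).
Proof.
split; first by exists [::].
  move=> P Q [F PF] [F' QF']; exists (F ++ F') => h hFF'.
  by split; [apply: PF|apply: QF'] => u uF; apply: hFF'; rewrite mem_cat uF ?orbT.
by move=> P Q PQ [F PF]; exists F => h /PF /PQ.
Qed.

(** Near a point with nonzero weight at [u], agreement on [ball2 u] suffices; compactness leaves
    finitely many such [u]. *)
Lemma compact_agree (g : AutT) (K : set Real) : compact K ->
  agree_filter g [set h | forall w, K w -> realize h w = realize g w].
Proof.
have FF := agree_filter_filter g.
move=> /compact_near_coveringP/(_ _ _ (fun h w => realize h w = realize g w) FF).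
apply=> w Kw; have [u wu] := realization_neq0 (set_valP w).
exists ([set z : Real | set_val z u != 0%R], agree (ball2 u) g); first split.
- by apply: open_nbhs_nbhs; split; [exact: open_neq0|].
- by exists (ball2 u).
- by case=> z h [/= zu hg]; exact: realize_agree zu hg.
Qed.

(** The compact-open topology is pointwise convergence on vertices: [open_autv] gives one direction,
    [compact_agree] the other. *)
Lemma nbhs_agree (g : AutT) (A : set AutT) : nbhs g A <-> exists F, agree F g `<=` A.
Proof.
split=> [|[F FA]]; last first.
  apply: filterS FA _; elim: F => [|u F IH].
    by apply: filterS filterT => h _ u; rewrite in_nil.
  have : nbhs g [set h : AutT | autv h u = autv g u].
    by apply: open_nbhs_nbhs; split; [exact: open_autv|].
  apply: filterS2 IH => h hF hu v; rewrite inE => /orP[/eqP->|] //; exact: hF.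
case=> _ [[B oB <-] gB BA].
have FF := agree_filter_filter g.
have cvg : ((@realize R X_CK) @ agree_filter g : set_system {compact-open, Real -> Real})
    --> (realize g : {compact-open, Real -> Real}).
  apply/compact_open_cvgP => K O cK oO gKO.
  have [F FK] := compact_agree g cK.
  by exists F => h /FK hg _ [w Kw <-]; rewrite hg //; apply: gKO; exists w.
have [|F FB] := cvg B; first exact: open_nbhs_nbhs.
by exists F => h /FB; exact: BA.
Qed.

End AutTopology.

(** * The properties of Aut^+ and of the coset space *)

Section Conclusion.
Local Open Scope quotient_scope.
Local Open Scope group_scope.

(* Infinitely many pairwise disjoint half-spaces: one of them avoids F. *)
Lemma autplus_far (F : seq Gamma_CK) : exists g : aut X_CK,
  [/\ autplus X_CK g, g <> 1 & forall u, u \in F -> autv g u = u].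
Proof.
pose x : letter := (ga, false); pose k i := comb gone x i.
have [i ki] : exists i, forall u, u \in F -> ~~ sep (k i) u.
  (* Asking for all larger indices allows induction on [F], as each vertex lies in at most one
     half-space. *)
  suff [i ki] : exists i, forall j, i <= j -> forall u, u \in F -> ~~ sep (k j) u.
    by exists i; exact: ki.
  elim: F => [|u F [i ki]]; first by exists 0%N.
  have [[j ju]|nu] := pselect (exists j, sep (k j) u); last first.
    exists i => j ij v; rewrite inE => /orP[/eqP->|]; last exact: ki.
    by apply/negP => ju; apply: nu; exists j.
  exists (maxn i j.+1) => l; rewrite geq_max => /andP[il jl] v.
  rewrite inE => /orP[/eqP->|]; last exact: ki.
  by apply: (comb_disjoint (erefl : x.1 = ga) _ ju); rewrite neq_ltn jl.
pose p := gline gd gone i; pose q := gact p x.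
(* Flipping only [d] fixes the [a]-hyperplane crossed at [q], yet moves the [d]-neighbours of [q] on
   its far side. *)
pose phi := amove (fun s => s == gd) q q.
have lphi : lpa phi by exact: amove_lp.
have phiq : autv phi q = q by exact: gmove_base.
have phix y : autv phi (gact q y) = gact q (flip (fun s => s == gd) y).
  by rewrite /= gmove_gact gmove_base.
have fixphi : carrier_fixed (k i) phi.
  rewrite -[k i]dinvK; apply: carrier_fixed_dinv.
  apply: (leaf_carrier_fixed leaf_ga lphi phiq); rewrite phix //.
have [g lg gE] := glue_exists lphi fixphi.
have kp : sep (k i) p = false by exact: (sep_org (k i)).
have kq : sep (k i) q by exact: (sep_tgt (k i)).
exists g; split.
- by apply: (@lpa_stab_autplus _ p) => //; rewrite gE /glue kp.
- move=> g1; have : autv g (gact q (gd, false)) = gact q (gd, false) by rewrite g1.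
  by rewrite gE /glue sep_gact_label // kq phix => /gact_inj.
- by move=> u /ki /negPf kiu; rewrite gE /glue kiu.
Qed.

Lemma autplus_simple : simple_subgroup (autplus X_CK).
Proof.
split; first exact: autplus_subgroup.
  have [g [gP g1 _]] := autplus_far [::]; move=> E.
  by move: gP; rewrite E => /g1.
move=> N nN; have [NE|N1] := pselect (N = [set 1]); first by left.
right; have [sN NG _] := nN; apply/seteqP; split=> //.
by apply: autplus_fixers => // e g; exact: normal_fixer.
Qed.

Variable R : realType.
Local Notation AutT := (aut_top R X_CK).
Local Notation G := (autplus_top R X_CK).

Lemma autplus_not_discrete : ~ discrete_space G.
Proof.
have [G1 _ _] := autplus_subgroup.
pose o : G := SigSub (mem_set G1).
move=> /(_ [set o]) [B oB BE].
have Bo : B (set_val o) by have : [set o] o by []; rewrite -BE.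
have [F FB] : exists F, agree F (1 : aut X_CK) `<=` B.
  by apply/nbhs_agree; exact: open_nbhs_nbhs.
have [g [gP g1 gF]] := autplus_far F.
pose g' : G := SigSub (mem_set gP); apply: g1.
have : [set o] g' by rewrite -BE; apply: FB => u /gF.
by move=> /(congr1 set_val).
Qed.

Lemma open_autplus_val (u : Gamma_CK) (P : set Gamma_CK) :
  open [set g : G | P (autv (set_val g : aut X_CK) u)].
Proof. by exists [set g : AutT | P (autv g u)] => //; exact: open_autv_set. Qed.

Lemma autplus_totally_disconnected : totally_disconnected [set: G].
Proof.
apply: zero_dimension_totally_disconnected => g h gh.
have [u uP] : exists u : Gamma_CK,
    autv (set_val g : aut X_CK) u <> autv (set_val h : aut X_CK) u.
  apply: contrapT => H; case/eqP: gh; apply: val_inj; apply: aut_ext => u.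
  by apply: contrapT => nu; apply: H; exists u.
exists [set k : G | autv (set_val k : aut X_CK) u = autv (set_val g : aut X_CK) u].
split=> //; last exact/nesym.
split; first exact: (@open_autplus_val u [set v | v = _]).
rewrite -[X in closed X]setCK; apply: open_closedC.
exact: (@open_autplus_val u [set v | v <> _]).
Qed.

(* An ultrafilter converges vertexwise: each vertex has finitely many possible
   images once the image of v is known. *)
Lemma autplus_sphere_compact (v w : Gamma_CK) :
  compact [set g : G | autv (set_val g : aut X_CK) v = w].
Proof.
rewrite compact_ultra => F UF Fv.
have lpG (g : G) : lpa (set_val g) by apply: autplus_lp; exact: set_valP.
have FF : ProperFilter F by exact: ultra_proper.
have [f fF] : exists f : Gamma_CK -> Gamma_CK,
    forall u, F [set g : G | autv (set_val g : aut X_CK) u = f u].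
  suff H u : exists z, F [set g : G | autv (set_val g : aut X_CK) u = z].
    by exists (fun u => projT1 (cid (H u))) => u; case: cid.
  elim/(@gamma_ind_from v): u => [|u x [z Fz]]; first by exists w.
  have [|H|H] := ultra_or (B := [set g : G | autv (set_val g : aut X_CK) (gact u x) = gact z x])
    (C := [set g : G | autv (set_val g : aut X_CK) (gact u x) = gact z (linv x)]) UF Fz.
  - by move=> g /= <-; exact: lpG.
  - by exists (gact z x).
  - by exists (gact z (linv x)).
(* The limit of the inverses makes the limit [f] bijective. *)
have [h hF] : exists h : Gamma_CK -> Gamma_CK,
    forall u, F [set g : G | autVv (set_val g : aut X_CK) u = h u].
  suff H u : exists z, F [set g : G | autVv (set_val g : aut X_CK) u = z].
    by exists (fun u => projT1 (cid (H u))) => u; case: cid.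
  elim/(@gamma_ind_from w): u => [|u x [z Fz]].
    by exists v; apply: filterS Fv => g /= <-; exact: (autvK (set_val g : aut X_CK)).
  have [|H|H] := ultra_or (B := [set g : G | autVv (set_val g : aut X_CK) (gact u x) = gact z x])
    (C := [set g : G | autVv (set_val g : aut X_CK) (gact u x) = gact z (linv x)]) UF Fz.
  - by move=> g /= <-; exact: (lpaV (lpG g)).
  - by exists (gact z x).
  - by exists (gact z (linv x)).
have fh : cancel f h.
  move=> u; have [g [/= <- <-]] := filter_ex (filterI (hF (f u)) (fF u)).
  exact: (autvK (set_val g : aut X_CK)).
have hf : cancel h f.
  move=> u; have [g [/= <- <-]] := filter_ex (filterI (fF (h u)) (hF u)).
  exact: (autVvK (set_val g : aut X_CK)).
have lf : lp f.
  move=> u x; have [g [/= <- <-]] := filter_ex (filterI (fF (gact u x)) (fF u)).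
  exact: lpG.
have lh : lp h.
  move=> u x; have [g [/= <- <-]] := filter_ex (filterI (hF (gact u x)) (hF u)).
  exact: (lpaV (lpG g)).
pose k := lp_aut lf lh fh hf.
have [g0 [/= g0v fv]] := filter_ex (filterI Fv (fF v)).
(* [k] agrees at [v] with [g0] in Aut^+, so they differ by a label preserving element fixing [v]. *)
have kP : autplus X_CK k.
  have [_ GM GV] := autplus_subgroup.
  have g0P : autplus X_CK (set_val g0) by exact: set_valP.
  rewrite -[k](mulVKg (set_val g0 : aut X_CK)); apply: (GM _ _ g0P).
  apply: (@lpa_stab_autplus _ v); first by apply: lpaM => //; exact: (lpaV (lpG g0)).
  rewrite [LHS](_ : _ = autVv (set_val g0 : aut X_CK) (f v)) // -fv.
  exact: (autvK (set_val g0 : aut X_CK)).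
pose k' : G := SigSub (mem_set kP).
exists k'; split; first by rewrite /= -g0v fv.
move=> A [_ [[B oB <-] kB BA]].
have [E EB] : exists E, agree E (k : AutT) `<=` B.
  by apply/nbhs_agree; exact: open_nbhs_nbhs.
have : F [set g : G | agree E k (set_val g)].
  elim: (E) => [|u E' IH]; first by apply: filterS filterT => g _ u; rewrite in_nil.
  apply: filterS2 IH (fF u) => g gE gu z; rewrite inE => /orP[/eqP->|] //.
  exact: gE.
by apply: filterS => g /EB; exact: BA.
Qed.

Lemma autplus_locally_compact : locally_compact [set: G].
Proof.
move=> g _.
exists [set k : G | autv (set_val k : aut X_CK) gone = autv (set_val g : aut X_CK) gone].
  have : nbhs g [set k : G |
      autv (set_val k : aut X_CK) gone = autv (set_val g : aut X_CK) gone].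
    by apply: open_nbhs_nbhs; split; [exact: (@open_autplus_val gone [set v | v = _])|].
  by apply: filterS => k kg _.
split; first exact: autplus_sphere_compact.
rewrite -[X in closed X]setCK; apply: open_closedC.
exact: (@open_autplus_val gone [set v | v <> _]).
Qed.

Local Notation N := (closure G).

Definition level (g : aut X_CK) : int := (pos (autv g gone)).1.

Lemma level_closure (g n : aut X_CK) : N n -> level (g * n) = level g.
Proof.
move=> /(_ [set h : AutT | autv h gone = autv n gone])[|n' [Gn' /= n'n]].
  by apply: open_nbhs_nbhs; split; [exact: open_autv|].
rewrite /level -(pos_autplus g Gn'); congr (pos _).1.
exact: (congr1 (autv g) (esym n'n)).
Qed.

Lemma level_coset (g h : AutT) :
  \pi_(coset_space N) g = \pi_(coset_space N) h -> level g = level h.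
Proof.
move=> /eqmodP/asboolP E.
have N1 : N (1 : aut X_CK).
  by apply: subset_closure; have [] := autplus_subgroup.
have : lcoset (N : set (aut X_CK)) h h by exists 1 => //; rewrite mulg1.
by rewrite -E => -[n Nn <-]; rewrite level_closure.
Qed.

(** The sets [U m] form an increasing open cover, so compactness would bound the level, against
    [pos_unbounded]. *)
Lemma coset_space_not_compact : ~ compact [set: coset_space N].
Proof.
pose U (m : nat) : set (coset_space N) :=
  [set q | exists g : AutT, q = \pi_(coset_space N) g /\ (level g < Posz m)%R].
have oU m : open (U m).
  suff : open (\pi_(coset_space N) @^-1` U m) by [].
  have -> : \pi_(coset_space N) @^-1` U m = [set g : AutT | (level g < Posz m)%R].
    apply/seteqP; split=> g /=; last by exists g.
    by case=> h [/level_coset ->].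
  exact: (@open_autv_set R gone [set v | ((pos v).1 < Posz m)%R]).
move=> /compact_near_coveringP/(_ _ \oo (fun m q => U m q) _)[q _|m _ mU].
  have [g ->] : exists g : AutT, q = \pi_(coset_space N) g.
    by exists (repr q); rewrite reprK.
  pose m0 := `|level g|%N.+1.
  have m0P : (level g < Posz m0)%R by rewrite /m0; lia.
  exists (U m0, [set m | m0 <= m]); first split.
  - by apply: open_nbhs_nbhs; split; [exact: oU|exists g].
  - by exists m0.
  - case=> _ m [/= [h [-> hm0]] m0m]; exists h; split=> //.
    by apply: lt_le_trans hm0 _; rewrite lez_nat.
have [g gm] := pos_unbounded m.
have [//|h [/level_coset]] := mU m (leqnn m) (\pi_(coset_space N) (g : AutT)).
by rewrite {1}/level gm => <-; lia.
Qed.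

End Conclusion.

Theorem theorem9 (R : realType) :
  ~ compact [set: coset_space (closure (autplus_top R X_CK))] /\
  [/\ simple_subgroup (autplus X_CK),
      ~ discrete_space (autplus_top R X_CK),
      totally_disconnected [set: autplus_top R X_CK] &
      locally_compact [set: autplus_top R X_CK]].
Proof.
split; first exact: coset_space_not_compact.
split; [exact: autplus_simple|exact: autplus_not_discrete|
  exact: autplus_totally_disconnected|exact: autplus_locally_compact].
Qed.
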